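(* Let $K$ be a finite pure $k$-dimensional simplicial complex ($k\ge1$) on the vertex set $[n]=\{1,\dots,n\}$. Then $$\lambda(K)=d^{\mathrm v}(K)^{\mathsf T}$$ if and only if $K$ is isomorphic to a shifted simplicial complex. Moreover, if equality holds, then every labelling of the vertices for which $\deg_K(1)\ge\deg_K(2)\ge\cdots\ge\deg_K(n)$ is shifted, i.e. $K$ is a shifted complex in that labelling.
   Context: A simplicial complex $K$ on a finite vertex set is a collection of subsets closed under taking subsets; a face with $m+1$ vertices has dimension $m$, and $K_j$ is the set of $j$-dimensional faces. $K$ is $k$-dimensional if $k$ is the largest dimension of a face, and pure if every face lies in a $k$-face. Choose an orientation (an ordering of the vertices, up to even permutations) of each face. The boundary matrix $B_k=([\sigma:F])_{\sigma\in K_{k-1},F\in K_k}$ has $[\sigma:F]=0$ if $\sigma\not\subset F$, and if $F=[v_0,\dots,v_k]$ and $\sigma=F\setminus\{v_i\}$ then $[\sigma:F]=(-1)^i\operatorname{sgn}(\pi)$, where $\pi$ is the permutation carrying $(v_0,\dots,\widehat{v_i},\dots,v_k)$ to the chosen ordering of $\sigma$. The up-Laplacian is $L^{\mathrm{up}}_{k-1}(K)=B_kB_k^{\mathsf T}$; its spectrum does not depend on the orientations. $\lambda(K)=(\lambda_1(K),\lambda_2(K),\dots)$ is the sequence of its nonzero eigenvalues, counted with multiplicity, in nonincreasing order (trailing zeroes are suppressed when sequences are compared). $\deg_K(v)=|\{\sigma\in K_k: v\in\sigma\}|$. $d^{\mathrm v}(K)$ is the sequence of vertex degrees in nonincreasing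 order, and its conjugate partition $d^{\mathrm v}(K)^{\mathsf T}$ has $r$th entry $d^{\mathrm v,\mathsf T}_r(K)=|\{i\in[n]:\deg_K(i)\ge r\}|$, $r\ge1$. For $t$-element subsets $F=\{f_1<\cdots<f_t\}$ and $G=\{g_1<\cdots<g_t\}$ of $[n]$, write $F\le_P G$ if $f_r\le g_r$ for all $r$. A simplicial complex $K$ on $[n]$ is shifted if whenever $G\in K$, $F\subseteq[n]$, $|F|=|G|$ and $F\le_P G$, then $F\in K$. Isomorphic means equal after a bijective relabelling of the vertices. *)

(* Defs.v *)
From mathcomp Require Import all_boot all_order all_fingroup all_algebra.
From mathcomp.real_closed Require Import polyrcf.

Set Implicit Arguments.
Unset Strict Implicit.
Unset Printing Implicit Defensive.

Import Order.TTheory GRing.Theory Num.Theory.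

Local Open Scope ring_scope.

(* The vertex set [n] is 'I_n with its natural order, numbered from 0.        *)
(* Vertices i with [set i] \notin K are allowed.                              *)

Section Complexes.

Variable n : nat.
Implicit Types (K : {set {set 'I_n}}) (F G : {set 'I_n}).

Definition simplicial_complex K : Prop :=
  forall F G, F \in K -> G \subset F -> G \in K.

Definition faces K (m : nat) : {set {set 'I_n}} := [set F in K | #|F| == m.+1].

(* For K = set0 and for K = [set set0] the maximum is 0, so that these have   *)
(* no dimension in the sense of this predicate.                               *)
Definition has_dim K (k : nat) : Prop := (\max_(F in K) #|F|)%N = k.+1.

Definition pure K (k : nat) : Prop :=
  forall F, F \in K -> exists2 G, G \in faces K k & F \subset G.

Definition deg K (k : nat) (v : 'I_n) : nat :=
  #|[set F in faces K k | v \in F]|.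

Definition conj_deg K (k r : nat) : nat := #|[set v | (r <= deg K k v)%N]|.

(* enum F lists the elements of F in increasing order; all2 is false on lists *)
(* of different lengths.                                                      *)
Definition le_P F G : bool :=
  all2 (fun i j : 'I_n => (i <= j)%N) (enum F) (enum G).

Definition shifted K : Prop :=
  forall F G, G \in K -> #|F| = #|G| -> le_P F G -> F \in K.

Definition relabel (p : {perm 'I_n}) K : {set {set 'I_n}} :=
  [set [set p x | x in F] | F : {set 'I_n} in K].

Definition isomorphic K K' : Prop := exists p : {perm 'I_n}, K' = relabel p K.

(* An orientation is given by one representative ordering of each face; its   *)
(* values outside K are irrelevant.                                           *)
Definition orientation K (o : {set 'I_n} -> seq 'I_n) : Prop :=
  forall F, F \in K -> perm_eq (o F) (enum F).

(* The permutation of the entries of s that carries s to t, for               *)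
(* duplicate-free s and t with the same entries.                              *)
Definition carry (s t : seq 'I_n) : {perm 'I_n} :=
  odflt 1%g [pick p : {perm 'I_n} | perm_on [set x in s] p && (map p s == t)].

(* At most one v in F satisfies s = F :\ v; its position in the ordering of F *)
(* is index v (o F), and rem v (o F) is that ordering with v omitted.         *)
Definition incidence (R : pzRingType) (o : {set 'I_n} -> seq 'I_n)
    (s F : {set 'I_n}) : R :=
  if [pick v in F | s == F :\ v] is Some v
  then (-1) ^+ index v (o F) * (-1) ^+ carry (rem v (o F)) (o s)
  else 0.

(* Used for k >= 1 only. *)
Definition boundary_mx (R : pzRingType) (o : {set 'I_n} -> seq 'I_n) K k :
    'M[R]_(#|faces K k.-1|, #|faces K k|) :=
  \matrix_(i, j) incidence R o (enum_val i) (enum_val j).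

Definition up_laplacian (R : pzRingType) (o : {set 'I_n} -> seq 'I_n) K k :
    'M[R]_#|faces K k.-1| :=
  boundary_mx R o K k *m (boundary_mx R o K k)^T.

End Complexes.

(* The roots in R of the characteristic polynomial, with multiplicity; these  *)
(* are all the eigenvalues when A is symmetric.                               *)
Definition eigenvalues (R : rcfType) (m : nat) (A : 'M[R]_m) : seq R :=
  flatten [seq nseq (mup x (char_poly A)) x | x <- rootsR (char_poly A)].

Definition spectrum (R : rcfType) (n : nat) (o : {set 'I_n} -> seq 'I_n)
    (K : {set {set 'I_n}}) (k : nat) : seq R :=
  sort >=%R [seq x <- eigenvalues (up_laplacian R o K k) | x != 0].

(* Equality of sequences up to trailing zeroes: the r-th entry of a list is 0 *)
(* past its end.                                                              *)
Definition spectrum_eq_conj_deg (R : rcfType) (n : nat)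
    (o : {set 'I_n} -> seq 'I_n) (K : {set {set 'I_n}}) (k : nat) : Prop :=
  forall r : nat, (spectrum R o K k)`_r = (conj_deg K k r.+1)%:R.

(* Main.v *)
Require Import Defs.
From mathcomp Require Import all_boot all_order all_fingroup all_algebra.
From mathcomp.real_closed Require Import polyrcf complex.
From mathcomp Require Import ring zify.

(** Let [S] be the set of [k]-faces and let [Delta], [Lambda] be the deletion and the link in [S]
    of the first vertex.

    If [S] is closed under replacing a vertex by a smaller one, the boundary of [Delta] lies
    in [Lambda], and the nonzero up-Laplacian eigenvalues of [S] are obtained by adding 1 to
    those of [Delta] and of [Lambda], padded by zeroes to [#|Lambda|] numbers in all.  The
    columns of the Ferrers diagram of the degrees obey the same recursion, because the degrees
    of [Delta] and [Lambda] are sorted in the same order and add up to those of [S].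

    Conversely, the sum of the squared eigenvalues is the trace of [L^2], which counts, over
    all pairs [(u, v)], the faces containing [u] and [v] plus the faces [F] containing [u] but
    not [v] for which [F - u + v] is again a face.  The sum of the squared conjugate degrees is
    the sum of [minn (deg u) (deg v)].  The former is at most the latter term by term, and
    equality says that the vertex neighbourhoods are nested, which is shiftedness for any
    labelling by decreasing degree. *)

Set Implicit Arguments.
Unset Strict Implicit.
Unset Printing Implicit Defensive.

Import Order.TTheory GRing.Theory Num.Theory.

Local Open Scope ring_scope.

(** * Signs of reorderings *)

Section Carry.

Variable n : nat.
Implicit Types (s t u : seq 'I_n) (p q : {perm 'I_n}) (v x : 'I_n).

(** Uniqueness: off [s] a permutation supported there is the identity, and on [s] it is fixed by its
    values along the list. *)
Lemma carry_eq s t p :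
  perm_on [set x in s] p -> map p s = t -> carry s t = p.
Proof.
move=> pon ps; rewrite /carry; case: pickP => [q /andP[qon /eqP qs]|/(_ p)]; last first.
  by rewrite pon ps eqxx.
apply/permP => x /=; have [xs|xNs] := boolP (x \in s).
  have /eq_in_map -> // : map q s = map p s by rewrite qs ps.
by rewrite (out_perm qon) ?(out_perm pon) // inE.
Qed.

Lemma carryP s t : uniq s -> perm_eq s t ->
  perm_on [set x in s] (carry s t) /\ map (carry s t) s = t.
Proof.
move=> us st.
pose f x := if x \in s then nth x t (index x s) else x.
have ut : uniq t by rewrite -(perm_uniq st).
have szt := perm_size st.
have fs x : x \in s -> f x \in s.
  by move=> xs; rewrite /f xs (perm_mem st) mem_nth // -szt index_mem.
have f_inj : injective f.
  move=> x y; case xs: (x \in s); case ys: (y \in s).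
  - rewrite /f xs ys (set_nth_default x y) -?szt ?index_mem // => /eqP.
    rewrite nth_uniq -?szt ?index_mem // => /eqP e.
    by rewrite -(nth_index x xs) e nth_index.
  - by move=> e; move: (fs x xs); rewrite e /f ys ys.
  - by move=> e; move: (fs y ys); rewrite -e /f xs xs.
  - by rewrite /f xs ys.
have pon : perm_on [set x in s] (perm f_inj).
  apply/subsetP => x; rewrite !inE permE /f; case: ifP => //; by rewrite eqxx.
have ps : map (perm f_inj) s = t.
  have [/size0nil s0|] := posnP (size s).
    by move: szt; rewrite s0 => /esym/size0nil ->.
  case E: {1}s => [//|x0 s'] _.
  apply: (@eq_from_nth _ x0); rewrite ?size_map // => i lti.
  rewrite (nth_map x0) // permE /f mem_nth // index_uniq //.
  by apply: set_nth_default; rewrite -szt.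
by rewrite (carry_eq pon ps).
Qed.

Lemma carry_perm_on s t : uniq s -> perm_eq s t -> perm_on [set x in s] (carry s t).
Proof. by move=> us /(carryP us)[]. Qed.

Lemma map_carry s t : uniq s -> perm_eq s t -> map (carry s t) s = t.
Proof. by move=> us /(carryP us)[]. Qed.

Lemma carry_trans s t u : uniq s -> perm_eq s t -> perm_eq t u ->
  carry s u = (carry s t * carry t u)%g.
Proof.
move=> us st tu; have ut : uniq t by rewrite -(perm_uniq st).
apply: carry_eq; last first.
  transitivity (map (carry t u) (map (carry s t) s)); last by rewrite !map_carry.
  by rewrite -map_comp; apply: eq_map => x; rewrite /= permM.
apply: perm_onM; first exact: carry_perm_on.
have -> : [set x in s] = [set x in t] by apply/setP => x; rewrite !inE (perm_mem st).
exact: carry_perm_on.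
Qed.

Lemma carry_cons v s t : uniq (v :: s) -> perm_eq s t ->
  carry (v :: s) (v :: t) = carry s t.
Proof.
move=> /= /andP[vs us] st; apply: carry_eq.
  apply: subset_trans (carry_perm_on us st) _.
  by apply/subsetP => x; rewrite !inE => ->; rewrite orbT.
by rewrite /= map_carry // (out_perm (carry_perm_on us st)) ?inE.
Qed.

Lemma carry_swap v x s : uniq [:: v, x & s] ->
  carry [:: v, x & s] [:: x, v & s] = tperm v x.
Proof.
move=> /= /andP[]; rewrite inE negb_or => /andP[vx vs] /andP[xs us].
apply: carry_eq.
  apply/subsetP => y; rewrite !inE; case: tpermP => [->|->|]; rewrite ?eqxx ?orbT //.
rewrite /= tpermL tpermR; congr [:: _, _ & _].
rewrite -[RHS]map_id; apply/eq_in_map => y ys.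
by case: tpermP => // e; move: ys; rewrite e ?(negPf vs) ?(negPf xs).
Qed.

(** Bringing [v] to the front passes it over [index v s] entries, one transposition each. *)
Lemma odd_carry_front v s : uniq s -> v \in s ->
  odd_perm (carry s (v :: rem v s)) = odd (index v s).
Proof.
elim: s => [|x s IH] //= /andP[xs us]; rewrite inE.
have [<- _|xv /= vs] := eqVneq x v.
  rewrite (@carry_eq _ _ 1%g) ?odd_perm1 ?perm_on1 //.
  by rewrite -[RHS]map_id; apply: eq_map => y; rewrite perm1.
have vs' : perm_eq s (v :: rem v s) by exact: perm_to_rem.
have uvs : uniq (v :: rem v s) by rewrite -(perm_uniq vs').
have xrs : x \notin v :: rem v s by rewrite -(perm_mem vs').
rewrite (@carry_trans _ [:: x, v & rem v s]) /= ?xs ?perm_cons //.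
  2: by apply/permPl; exact: perm_catCA [:: x] [:: v] (rem v s).
rewrite odd_permM carry_cons //= ?xs // IH //.
by rewrite carry_swap ?odd_tperm ?xv ?addbT //= xrs.
Qed.

(** The routes from [s] to [v :: rem v t] through [t] and through [v :: rem v s] give the same
    permutation; each move of [v] to the front contributes the parity of an index. *)
Lemma odd_carry_rem v s t : uniq s -> perm_eq s t -> v \in s ->
  odd_perm (carry (rem v s) (rem v t)) =
  odd_perm (carry s t) (+) odd (index v s) (+) odd (index v t).
Proof.
move=> us st vs; have ut : uniq t by rewrite -(perm_uniq st).
have vt : v \in t by rewrite -(perm_mem st).
have srs := perm_to_rem vs; have trt := perm_to_rem vt.
have urs : uniq (v :: rem v s) by rewrite -(perm_uniq srs).
have rst : perm_eq (rem v s) (rem v t).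
  by rewrite -(perm_cons v) -(permPl srs) -(permPr trt).
rewrite -(carry_cons urs rst) -(odd_carry_front us vs) -(odd_carry_front ut vt).
have e : (carry s t * carry t (v :: rem v t) =
          carry s (v :: rem v s) * carry (v :: rem v s) (v :: rem v t))%g.
  by rewrite -!carry_trans ?perm_cons.
rewrite -addbA (addbC (odd_perm _)) addbAC -addbA -odd_permM e odd_permM.
by rewrite addbA addbb.
Qed.

End Carry.

(** * Incidence numbers under reorientation and relabelling *)

Section Signs.

Variable n : nat.
Implicit Types (s t : seq 'I_n) (p : {perm 'I_n}) (F G : {set 'I_n}) (u v : 'I_n).

Lemma carry_map p s t : uniq s -> perm_eq s t ->
  carry (map p s) (map p t) = (carry s t ^ p)%g.
Proof.
move=> us st; apply: carry_eq; last first.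
  rewrite -[in RHS](map_carry us st) -!map_comp; apply: eq_map => x /=.
  by rewrite permJ.
apply/subsetP => x; rewrite !inE -[x](permKV p) permJ (inj_eq perm_inj) => xm.
rewrite mem_map; last exact: perm_inj.
by have /subsetP/(_ (p^-1%g x)) := carry_perm_on us st; rewrite !inE; apply.
Qed.

Lemma rem_enum F v : v \in F -> rem v (enum F) = enum (F :\ v).
Proof.
move=> vF; rewrite rem_filter ?enum_uniq // {2}/enum_mem -enumT /= enumT.
rewrite /enum_mem -filter_predI; apply: eq_filter => x.
by rewrite /= !inE.
Qed.

Definition pos v F : nat := #|[set u in F | (u < v)%N]|.

Lemma index_enum v F : v \in F -> index v (enum F) = pos v F.
Proof.
have -> : pos v F = count (fun u : 'I_n => (u < v)%N) (enum F).
  rewrite /pos cardE -size_filter; congr size.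
  rewrite {1}/enum_mem /enum_mem -filter_predI; apply: eq_filter => x.
  by rewrite /= !inE andbC.
rewrite -mem_enum; have: sorted (fun i j : 'I_n => (i < j)%N) (enum F).
  rewrite /enum_mem; apply: sorted_filter; first by move=> ? ? ?; exact: ltn_trans.
  by rewrite -enumT -(@sorted_map _ _ val ltn) val_enum_ord iota_ltn_sorted.
elim: (enum F) => [//|x s IH] /=; rewrite (path_sortedE (fun _ _ _ => @ltn_trans _ _ _)).
move=> /andP[xs ss]; rewrite inE eq_sym; case: eqVneq => [<- _|xv /= vs].
  rewrite ltnn add0n; apply/esym/eqP; rewrite -leqn0 leqNgt -has_count.
  apply/hasPn => u /(allP xs) /=; by rewrite -leqNgt => /ltnW.
by rewrite IH // (allP xs v vs).
Qed.

Variable A : comPzRingType.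

(* The incidence number for the increasing orientation of all subsets. *)
Definition bd G F : A := \sum_(v in F | G == F :\ v) (-1) ^+ pos v F.

Lemma bdE F v : v \in F -> bd (F :\ v) F = (-1) ^+ pos v F.
Proof.
move=> vF; rewrite /bd (big_pred1 v) // => u /=.
apply/andP/eqP => [[uF /eqP/setP/(_ u)]|->]; last by rewrite vF.
by rewrite !inE eqxx uF andbT /= => /negbFE/eqP.
Qed.

Definition orient_sign (o : {set 'I_n} -> seq 'I_n) p F : A :=
  (-1) ^+ carry (map p (o F)) (enum (p @: F)).

Lemma orient_sign_sqr o p F : orient_sign o p F * orient_sign o p F = 1.
Proof. by rewrite /orient_sign -expr2 sqrr_sign. Qed.

Lemma enum_imset p F : perm_eq (map p (enum F)) (enum (p @: F)).
Proof.
apply: uniq_perm; rewrite ?enum_uniq ?map_inj_uniq ?enum_uniq //; try exact: perm_inj.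
move=> x; rewrite mem_enum; apply/mapP/imsetP => [] [y yF ->]; exists y => //.
  by rewrite mem_enum in yF.
by rewrite mem_enum.
Qed.

Lemma imset_setD1 p F v : p @: (F :\ v) = (p @: F) :\ p v.
Proof.
apply/setP => x; rewrite -[x](permKV p) !inE !mem_imset ?inE; try exact: perm_inj.
by rewrite (inj_eq perm_inj).
Qed.

Lemma map_perm_rem p v s : map p (rem v s) = rem (p v) (map p s).
Proof. by elim: s => //= x s IH; rewrite (inj_eq perm_inj); case: ifP => //= _; rewrite IH. Qed.

(** Passing to the increasing orientation of the relabelled faces only multiplies rows and columns
    by signs; [odd_carry_rem] for the transported orderings supplies them. *)
Lemma incidence_bd o p G F :
  perm_eq (o G) (enum G) -> perm_eq (o F) (enum F) ->
  incidence A o G F =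
  orient_sign o p G * bd (p @: G) (p @: F) * orient_sign o p F.
Proof.
move=> oG oF; rewrite /incidence; case: pickP => [v /andP[vF /eqP eG]|noF]; last first.
  rewrite /bd big1 ?mulr0 ?mul0r // => v' /andP[/imsetP[v vF ->]].
  rewrite -imset_setD1 => /eqP/(imset_inj (@perm_inj _ p)) e.
  by move: (noF v); rewrite vF e eqxx.
have pvF : p v \in p @: F by rewrite imset_f.
have uoF : uniq (o F) by rewrite (perm_uniq oF) enum_uniq.
have voF : v \in o F by rewrite (perm_mem oF) mem_enum.
have poF : perm_eq (map p (o F)) (enum (p @: F)).
  by rewrite -(permPr (enum_imset p F)) perm_map.
have poG : perm_eq (map p (o G)) (enum (p @: G)).
  by rewrite -(permPr (enum_imset p G)) perm_map.
have e : p @: G = (p @: F) :\ p v.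
  by rewrite eG imset_setD1.
have upoF : uniq (map p (o F)) by rewrite map_inj_uniq //; exact: perm_inj.
have := odd_carry_rem upoF poF; move=> /(_ (p v)).
rewrite map_f // => /(_ isT).
rewrite -map_perm_rem.
have roG : perm_eq (rem v (o F)) (o G).
  rewrite (permPr oG) eG -rem_enum // -(perm_cons v) -(permPl (perm_to_rem voF)) (permPl oF).
  by rewrite perm_to_rem ?mem_enum.
rewrite rem_enum // -e (@carry_trans _ _ (map p (o G))) ?perm_map //; last first.
  by rewrite map_inj_uniq ?rem_uniq //; exact: perm_inj.
rewrite carry_map ?rem_uniq // odd_permM odd_permJ index_map; last exact: perm_inj.
rewrite index_enum // => sgn; rewrite e bdE // /orient_sign.
rewrite -[in LHS]signr_odd -[in RHS](signr_odd _ (pos _ _)) -!signr_addb.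
congr (_ ^+ (nat_of_bool _)); move: sgn.
case: (odd (index _ _)) (odd (pos _ _)) => [] [] /=;
  case: (odd_perm (carry (rem _ _) _)) (odd_perm (carry _ (enum (p @: G))))
        (odd_perm (carry _ (enum (p @: F)))) => [] [] [] //=.
Qed.

End Signs.

(** * Determinants *)

Section Determinants.

(** The block matrix [X] is made block triangular by a factor on the right and by another on the
    left; the powers of [y] replace a division. *)
Lemma det_sub_mulmxC (A : comNzRingType) (p q : nat) (U : 'M[A]_(p, q)) (V : 'M_(q, p)) y :
  \det (y%:M - U *m V) * y ^+ q = y ^+ p * \det (y%:M - V *m U).
Proof.
pose X := block_mx y%:M U V 1%:M.
have e1 : \det X = \det (y%:M - U *m V).
  have e : X *m block_mx 1%:M 0 (- V) 1%:M = block_mx (y%:M - U *m V) U 0 1%:M.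
    by rewrite mulmx_block !mulmx1 !mulmx0 !mul1mx mulmxN !add0r subrr.
  move/(congr1 determinant): e; rewrite det_mulmx det_lblock det_ublock !det1 !mulr1.
  by [].
have : block_mx 1%:M 0 (- V) y%:M *m X = block_mx y%:M U 0 (y%:M - V *m U).
  rewrite mulmx_block !mul1mx !mul0mx !addr0 !mulmx1 mulNmx scalar_mxC addNr.
  by rewrite mulNmx addrC.
move/(congr1 determinant); rewrite det_mulmx det_lblock det_ublock det1 mul1r.
by rewrite !det_scalar e1 mulrC.
Qed.

Variables (A : idomainType) (N : nat).
Implicit Types (B M Q : 'M[A]_N) (y : A).

Lemma det_sub_mulmx_comm B M y : y != 0 ->
  \det (y%:M - B *m M) = \det (y%:M - M *m B).
Proof.
move=> y0; apply: (mulIf (expf_neq0 N y0)).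
by rewrite det_sub_mulmxC mulrC.
Qed.

(* The factorization [(Y - B) (Y - M) = (Y - B - M) Y] for [Y = y - Q]. *)
Lemma det_sub_orthogonal Q B M y : Q *m M = M *m Q -> B *m M = 0 ->
  \det (y%:M - (Q + B + M)) * \det (y%:M - Q) =
  \det (y%:M - (Q + B)) * \det (y%:M - (Q + M)).
Proof.
move=> QM BM; rewrite -!det_mulmx; congr determinant.
set Y := y%:M - Q.
have -> : y%:M - (Q + B + M) = Y - B - M by rewrite !opprD !addrA.
have -> : y%:M - (Q + B) = Y - B by rewrite opprD addrA.
have -> : y%:M - (Q + M) = Y - M by rewrite opprD addrA.
have YM : Y *m M = M *m Y by rewrite mulmxBl mulmxBr QM scalar_mxC.
clearbody Y.
by rewrite [RHS]mulmxBl !mulmxBr BM subr0 YM !mulmxBl addrAC.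
Qed.

Definition proj_mx (J : pred 'I_N) : 'M[A]_N := diag_mx (\row_i (J i)%:R).

Lemma proj_mx_idem J : proj_mx J *m proj_mx J = proj_mx J.
Proof.
apply/matrixP => i j; rewrite mul_diag_mx !mxE mulrnAr -natrM.
by case: (J i); rewrite ?mul0n ?mul1n.
Qed.

Lemma det_scale_proj_mx (J : pred 'I_N) (a b : A) :
  \det (a *: (1%:M - proj_mx J) + b *: proj_mx J) = a ^+ (N - #|J|) * b ^+ #|J|.
Proof.
have -> : a *: (1%:M - proj_mx J) + b *: proj_mx J
        = diag_mx (\row_i (if J i then b else a)).
  apply/matrixP => i j; rewrite !mxE; case: eqP => [_|_]; case: (J i); rewrite /=; ring.
rewrite det_diag; under eq_bigr do rewrite mxE.
rewrite (bigID J) /= mulrC; congr (_ * _).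
  rewrite (eq_bigr (fun=> a)) => [|i /negPf ->//]; rewrite prodr_const; congr (_ ^+ _).
  by rewrite -[N in (N - _)%N]card_ord -(cardC J) addKn; apply: eq_card.
by rewrite (eq_bigr (fun=> b)) => [|i ->//]; rewrite prodr_const.
Qed.

Lemma det_sub_proj_mx J y :
  \det (y%:M - proj_mx J) = y ^+ (N - #|J|) * (y - 1) ^+ #|J|.
Proof.
rewrite -det_scale_proj_mx; congr determinant.
by rewrite scalerBr scalerBl scale1r addrA subrK scalemx1.
Qed.

(** With $P$ the projection and $BP=B$, both sides are the determinant of $y(y-1)(1-P)+(y-1)P-B$.
    This is how adding a projection raises eigenvalues by 1. *)
Lemma det_sub_add_proj_mx J B y : B *m proj_mx J = B ->
  \det (y%:M - (proj_mx J + B)) * (y - 1) ^+ (N - #|J|) =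
  \det ((y - 1)%:M - B) * y ^+ (N - #|J|).
Proof.
move=> BP.
have := det_scale_proj_mx J (y - 1) 1; have := det_scale_proj_mx J y 1.
rewrite !expr1n !mulr1 => <- <-; rewrite -!det_mulmx; congr determinant.
set P := proj_mx J in BP *; have PP : P *m P = P := proj_mx_idem J.
rewrite !scale1r !mulmxDr -!scalemxAr !mulmxBr !mulmx1 !mulmxBl !mulmxDl PP BP.
rewrite !mul_scalar_mx.
apply/matrixP => i j; rewrite !mxE; case: (i == j); rewrite /=; ring.
Qed.

End Determinants.

(** * Ferrers diagrams *)

Section Columns.

Variables (A : comPzRingType) (I : Type).
Implicit Types (g : nat -> A) (d e : I -> nat) (l : seq I).

(* The product of [g] over the first [N] column lengths of the Ferrers diagram with rows
   [d i], [i] in [l]. *)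
Definition prod_cols g N d l := \prod_(r < N) g (count (fun i => r < d i)%N l).

Lemma prod_cols_nil g N d : prod_cols g N d [::] = g 0%N ^+ N.
Proof. by rewrite /prod_cols /= prodr_const card_ord. Qed.

Lemma prod_cols_widen g N M d l : (M <= N)%N -> all (fun i => d i <= M)%N l ->
  prod_cols g N d l = g 0%N ^+ (N - M) * prod_cols g M d l.
Proof.
move=> MN dM; rewrite /prod_cols.
rewrite -(big_mkord xpredT (fun r => g (count (fun i => r < d i)%N l))).
rewrite (@big_cat_nat _ _ _ M) //= mulrC big_mkord; congr (_ * _).
rewrite big_nat_cond (eq_bigr (fun=> g 0%N)) => [|r /andP[/andP[Mr _] _]].
  by rewrite -big_nat_cond prodr_const_nat.
congr g; apply/eqP; rewrite -leqn0 leqNgt -has_count -all_predC.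
by apply: sub_all dM => i di; rewrite /= -leqNgt (leq_trans di).
Qed.

(** The longest row puts one cell into each of the first [d i] columns, and the columns beyond are
    empty. *)
Lemma prod_cols_cons g N d i l : (d i <= N)%N -> all (fun j => d j <= d i)%N l ->
  prod_cols g N d (i :: l) = g 0%N ^+ (N - d i) * prod_cols (g \o S) (d i) d l.
Proof.
move=> diN dl; rewrite (prod_cols_widen _ diN) /= ?leqnn //; congr (_ * _).
by apply: eq_bigr => r _; rewrite /= ltn_ord.
Qed.

(* Conjugation turns the sum of two partitions into the union of their conjugates. *)
Lemma prod_cols_add g a b d e l :
    all (fun i => d i <= a)%N l -> all (fun i => e i <= b)%N l ->
    pairwise (fun i j => d j <= d i)%N l -> pairwise (fun i j => e j <= e i)%N l ->
  prod_cols g (a + b) (fun i => d i + e i)%N l = prod_cols g a d l * prod_cols g b e l.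
Proof.
elim: l g a b => [|i l IH] g a b; first by rewrite !prod_cols_nil exprD.
move=> /= /andP[da _] /andP[eb _] /andP[dl pd] /andP[el pe].
rewrite !prod_cols_cons ?leq_add //; last first.
  elim: l dl el {IH pd pe} => //= j l IH /andP[dj dl] /andP[ej el].
  by rewrite leq_add // IH.
rewrite IH // mulrACA -exprD; congr (_ ^+ _ * _); lia.
Qed.

End Columns.

(** * Boundary and cone operators on all vertex subsets *)

Section SubsetIndex.

Variable n : nat.
Notation N := #|{set 'I_n}|.

(** Indexing by the whole power set makes all operators between faces of any dimensions square of
    one size, at the price of extra zero eigenvalues. *)
Definition nth_set : 'I_N -> {set 'I_n} := enum_val.

Lemma nth_set_inj : injective nth_set.
Proof. exact: enum_val_inj. Qed.

Lemma nth_set_rank F : nth_set (enum_rank F) = F.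
Proof. exact: enum_rankK. Qed.

Lemma sum_nth_set (A : nmodType) (f : {set 'I_n} -> A) :
  \sum_i f (nth_set i) = \sum_F f F.
Proof. by rewrite [RHS]big_enum_val. Qed.

End SubsetIndex.

Section SubsetMatrices.

Variables (n : nat) (A : idomainType).
Notation N := #|{set 'I_n}|.
Implicit Types (f g : {set 'I_n} -> {set 'I_n} -> A) (S T : {set {set 'I_n}}).
Implicit Types (F G H : {set 'I_n}) (u v w : 'I_n).

Definition fun_mx f : 'M[A]_N := \matrix_(i, j) f (nth_set i) (nth_set j).

Lemma eq_fun_mx f g : (forall G F, f G F = g G F) -> fun_mx f = fun_mx g.
Proof. by move=> fg; apply/matrixP => i j; rewrite !mxE. Qed.

Lemma mul_fun_mx f g :
  fun_mx f *m fun_mx g = fun_mx (fun G F => \sum_H f G H * g H F).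
Proof.
apply/matrixP => i j; rewrite !mxE -sum_nth_set.
by apply: eq_bigr => l _; rewrite !mxE.
Qed.

Lemma tr_fun_mx f : (fun_mx f)^T = fun_mx (fun G F => f F G).
Proof. by apply/matrixP => i j; rewrite !mxE. Qed.

Definition face_proj S : 'M[A]_N := proj_mx A (fun i => nth_set i \in S).

Lemma face_projE S : face_proj S = fun_mx (fun G F => ((G == F) && (F \in S))%:R).
Proof.
apply/matrixP => i j; rewrite !mxE (inj_eq (@nth_set_inj n)).
by case: eqVneq => [->|_]; rewrite ?mulr1n.
Qed.

Lemma card_face_proj S : #|(fun i : 'I_N => nth_set i \in S)| = #|S|.
Proof.
rewrite -(card_imset _ (@nth_set_inj n)); apply: eq_card => F.
apply/imsetP/idP => [[i iS ->]//|FS]; exists (enum_rank F); last by rewrite nth_set_rank.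
by rewrite unfold_in nth_set_rank.
Qed.

Lemma mul_face_proj S f : face_proj S *m fun_mx f = fun_mx (fun G F => if G \in S then f G F else 0).
Proof.
apply/matrixP => i j; rewrite mul_diag_mx !mxE.
by case: ifP; rewrite ?mul1r ?mul0r.
Qed.

Lemma mul_fun_mx_proj S f : fun_mx f *m face_proj S = fun_mx (fun G F => if F \in S then f G F else 0).
Proof.
apply/matrixP => i j; rewrite mul_mx_diag !mxE.
by case: ifP; rewrite ?mulr1 ?mulr0.
Qed.

Lemma face_proj_sub S T : S \subset T -> face_proj T *m face_proj S = face_proj S.
Proof.
move=> ST; rewrite [face_proj S]face_projE mul_face_proj; apply: eq_fun_mx => G F.
case: eqVneq => [->|_] /=; last by case: ifP.
by case: (boolP (F \in S)) => [/(subsetP ST) ->//|]; case: ifP.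
Qed.

Lemma tr_face_proj S : (face_proj S)^T = face_proj S.
Proof. exact: tr_diag_mx. Qed.

Definition bd_mx : 'M[A]_N := fun_mx (bd A).

Lemma bd_proj S T : (forall F v, F \in S -> v \in F -> F :\ v \in T) ->
  face_proj T *m (bd_mx *m face_proj S) = bd_mx *m face_proj S.
Proof.
move=> shST; rewrite mul_fun_mx_proj mul_face_proj; apply: eq_fun_mx => G F.
case: ifP => // GT; case: ifP => // FS; rewrite /bd big1 // => v /andP[vF /eqP e].
by move: GT; rewrite e shST.
Qed.

Lemma pos_D1 u v F : v \in F -> pos u F = ((v < u) + pos u (F :\ v))%N.
Proof.
move=> vF; rewrite /pos (cardsD1 v) !inE vF /=; congr (_ + _)%N.
by apply: eq_card => x; rewrite !inE andbA.
Qed.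

(** Two vertices can be deleted in two orders, which lead to the same set with opposite signs. *)
Lemma bd_mx_bd_mx : bd_mx *m bd_mx = 0.
Proof.
rewrite mul_fun_mx; apply/matrixP => i j; rewrite !mxE.
move: (nth_set i) (nth_set j) => G F; rewrite /bd.
under eq_bigr do rewrite mulr_sumr.
rewrite (exchange_big_dep (fun v => v \in F)) /=; last by move=> ? ? _ /andP[].
under eq_bigr => v vF.
  under eq_bigl do rewrite vF /=.
  rewrite big_pred1_eq mulr_suml; over.
pose x v u : A := (-1) ^+ pos u (F :\ v) * (-1) ^+ pos v F.
rewrite (pair_big_dep _ _ x) /= (bigID (fun p : 'I_n * 'I_n => p.1 < p.2)%N) /=.
rewrite [X in _ + X](reindex_inj (inv_inj (@swap_pairK _ _))) /=.
set P := fun p : 'I_n * 'I_n => [&& p.1 \in F, p.2 \in F, G == F :\ p.1 :\ p.2 & (p.1 < p.2)%N].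
rewrite (eq_bigl P) => [|[v u]]; last first.
  rewrite /P /= !inE; case: (ltngtP v u) => [vu|//|]; rewrite ?andbF //.
  by rewrite -(inj_eq val_inj) gtn_eqF //= !andbT -?andbA.
rewrite [X in _ + X](eq_bigl P) => [|[v u]]; last first.
  rewrite /P /= !inE /=; case: (ltngtP v u) => [vu|//|/val_inj->]; rewrite ?eqxx ?andbF //.
  rewrite -(inj_eq val_inj) ltn_eqF //= !andbT -?andbA setDDl setUC -setDDl.
  by case: (v \in F); rewrite ?andbF.
rewrite -big_split big1 // => -[v u] /and4P[/= vF uF _ vu].
(* Removing the smaller vertex [v] lowers the position of [u] by one, while removing [u] leaves that
   of [v] unchanged. *)
rewrite /x (pos_D1 u vF) (pos_D1 v uF) vu ltnNge (ltnW vu) /= add0n.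
by rewrite exprS; ring.
Qed.

Definition up_lap S : 'M[A]_N := bd_mx *m face_proj S *m bd_mx^T.

Lemma tr_up_lap S : (up_lap S)^T = up_lap S.
Proof. by rewrite /up_lap !trmx_mul trmxK tr_face_proj mulmxA. Qed.

(** On [above w] the added vertex comes first, so the cone operator carries no sign. *)
Definition cone_mx w : 'M[A]_N := fun_mx (fun H F => ((w \notin F) && (H == w |: F))%:R).

Definition above w : {set {set 'I_n}} := [set F : {set 'I_n} | [forall v in F, (w < v)%N]].

Lemma aboveP w F : reflect (forall v, v \in F -> (w < v)%N) (F \in above w).
Proof. by rewrite inE; exact: forall_inP. Qed.

Lemma above_notin w F : F \in above w -> w \notin F.
Proof. by move/aboveP => Fw; apply/negP => /Fw; rewrite ltnn. Qed.

Lemma cone_pick w F f : w \notin F ->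
  \sum_H ((w \notin F) && (H == w |: F))%:R * f H F = f (w |: F) F.
Proof.
move=> wF; rewrite (bigD1 (w |: F)) //= wF eqxx mul1r big1 ?addr0 // => H /negPf ->.
by rewrite mul0r.
Qed.

Lemma cone_tr_above w : (cone_mx w)^T *m face_proj (above w) = 0.
Proof.
rewrite tr_fun_mx mul_fun_mx_proj; apply/matrixP => i j; rewrite !mxE.
case: ifP => // /above_notin wF; case: andP => // -[_ /eqP e].
by move: wF; rewrite e setU11.
Qed.

Lemma cone_tr_cone w :
  (cone_mx w)^T *m (cone_mx w *m face_proj (above w)) = face_proj (above w).
Proof.
rewrite tr_fun_mx mul_fun_mx_proj mul_fun_mx face_projE; apply: eq_fun_mx => G F.
case: (boolP (F \in above w)) => [/above_notin wF|FN]; last first.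
  by rewrite andbF big1 // => H _; rewrite mulr0.
under eq_bigr do rewrite mulrC.
rewrite (cone_pick (fun H _ => ((w \notin G) && (H == w |: G))%:R)) // andbT.
congr (nat_of_bool _)%:R; apply/idP/idP => [/andP[wG /eqP e]|/eqP->]; last by rewrite wF eqxx.
by rewrite -(setU1K wG) -e setU1K.
Qed.

(** Omitting [w] returns [F] with sign plus; omitting a vertex of [F] leaves a cone, with reversed
    sign because [w] shifts every position by one. *)
Lemma bd_cone w F G : F \in above w ->
  bd A G (w |: F) = (G == F)%:R - (w \in G)%:R * bd A (G :\ w) F.
Proof.
move=> Fw; have wF := above_notin Fw.
rewrite /bd big_mkcondr big_setU1 //=; congr (_ + _).
  rewrite setU1K // (_ : pos w (w |: F) = 0%N) ?expr0; first by case: ifP.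
  apply: eq_card0 => u; rewrite !inE; have [->|_] /= := eqVneq; first by rewrite ltnn.
  by apply/negP => /andP[/(aboveP _ _ Fw)]; case: ltngtP.
rewrite big_mkcondr mulr_sumr -sumrN; apply: eq_bigr => v vF.
have wv := aboveP _ _ Fw v vF.
have vw : w != v by rewrite -(inj_eq val_inj) ltn_eqF.
have -> : pos v (w |: F) = (pos v F).+1 by rewrite (pos_D1 _ (setU11 w F)) wv setU1K.
have -> : (G == (w |: F) :\ v) = (w \in G) && (G :\ w == F :\ v).
  apply/eqP/andP => [->|[wG /eqP e]].
    rewrite !inE vw eqxx; split=> //; apply/eqP/setP => x; rewrite !inE.
    by case: eqVneq => [->|]; rewrite ?(negPf wF) ?andbF.
  rewrite -(setD1K wG) e; apply/setP => x; rewrite !inE.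
  by case: (eqVneq x w) => [->|]; rewrite ?vw.
case: (w \in G) => /=; last by rewrite mul0r oppr0.
by rewrite mul1r; case: ifP => _; rewrite ?oppr0 // exprS mulN1r.
Qed.

(** The cone is a chain homotopy: $DC+CD$ is the identity on sets above [w]. *)
Lemma bd_mx_cone w :
  bd_mx *m (cone_mx w *m face_proj (above w)) =
  face_proj (above w) - cone_mx w *m (bd_mx *m face_proj (above w)).
Proof.
rewrite !mul_fun_mx_proj !mul_fun_mx face_projE; apply/matrixP => i j; rewrite !mxE.
move: (nth_set i) (nth_set j) => G F.
case: (boolP (F \in above w)) => [Fw|_]; last first.
  by rewrite andbF !big1 ?subr0 // => H _; rewrite mulr0.
under eq_bigr do rewrite mulrC.
rewrite (cone_pick (fun H F => bd A G H)) ?above_notin // bd_cone // andbT.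
congr (_ - _); case: (boolP (w \in G)) => wG; last first.
  rewrite mul0r big1 // => H _; case: andP => [[_ /eqP e]|]; last by rewrite mul0r.
  by move: wG; rewrite e setU11.
rewrite (bigD1 (G :\ w)) //= setD11 setD1K // eqxx big1 ?addr0 // => H HG.
case: andP => [[wH /eqP e]|]; last by rewrite mul0r.
by move: HG; rewrite e setU1K ?eqxx.
Qed.

Lemma bd_above w :
  face_proj (above w) *m (bd_mx *m face_proj (above w)) = bd_mx *m face_proj (above w).
Proof.
apply: bd_proj => F v /aboveP Fw vF; apply/aboveP => u.
by rewrite !inE => /andP[_ /Fw].
Qed.

Definition cone_link w S := [set F : {set 'I_n} | (w \notin F) && (w |: F \in S)].
Definition deletion w S := [set F in S | w \notin F].

Lemma face_proj_split w S :
  face_proj S = face_proj (deletion w S) +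
    cone_mx w *m face_proj (cone_link w S) *m (cone_mx w)^T.
Proof.
rewrite !face_projE -(face_projE (cone_link w S)) mul_fun_mx_proj tr_fun_mx mul_fun_mx.
apply/matrixP => i j; rewrite !mxE; move: (nth_set i) (nth_set j) => G F.
have [wF|wF] := boolP (w \in F); last first.
  rewrite big1 ?addr0 ?inE ?wF ?andbT // => H _.
  case: (boolP (_ && (F == _))) => [/andP[_ /eqP e]|_]; last by rewrite mulr0.
  by move: wF; rewrite e setU11.
rewrite inE wF /= !andbF add0r (bigD1 (F :\ w)) //= setD11 setD1K // eqxx mulr1.
rewrite !inE eqxx /= setD1K // big1 ?addr0 => [|H HF].
  by rewrite andbC; case: (F \in S); rewrite //= ?andbF.
case: (boolP (_ && (F == _))) => [/andP[wH /eqP e]|_]; last by rewrite mulr0.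
by move: HF; rewrite e setU1K ?eqxx.
Qed.

(* With [P] the projection on the link, [L] that of the deletion, [C] the cone operator
   and [D] the boundary, [C^T P = 0], [C^T C D P = D P] and [D C P = P - C D P]; hence the
   matrix [X = D C P] satisfies [X (P + L) X^T = up_lap S] and [X^T X = P + P D^T D P]. *)
Lemma det_up_lap_cone w S y : y != 0 ->
    {subset cone_link w S <= above w} ->
    {subset deletion w S <= above w} ->
    (forall F v, F \in deletion w S -> v \in F -> F :\ v \in cone_link w S) ->
  let m := #|cone_link w S| in
  \det (y%:M - up_lap S) * (y ^+ (N - m) * (y - 1) ^+ m) =
  \det (y%:M - (face_proj (cone_link w S) + up_lap (deletion w S))) *
  \det (y%:M - (face_proj (cone_link w S) +
                (bd_mx *m face_proj (cone_link w S))^T *m (bd_mx *m face_proj (cone_link w S)))).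
Proof.
move=> y0 linkw delw shadow m.
set P := face_proj (cone_link w S); set PD := face_proj (deletion w S).
set L := up_lap (deletion w S); set D := bd_mx; set C := cone_mx w.
set Q := face_proj (above w); set M := (_^T *m _).
have DD : D *m D = 0 := bd_mx_bd_mx.
have QP : Q *m P = P by apply: face_proj_sub; apply/subsetP.
have PP : P *m P = P by apply: face_proj_sub.
have PT : P^T = P := tr_face_proj _.
have LT : L^T = L := tr_up_lap _.
(* The hypothesis [shadow] enters here: boundaries of deletion faces lie in the link. *)
have PL : P *m L = L.
  by rewrite /L /up_lap mulmxA; congr (_ *m _); exact: bd_proj.
have LP : L *m P = L by rewrite -LT -{1}PT -trmx_mul PL.
have DL : D *m L = 0 by rewrite /L /up_lap !mulmxA DD !mul0mx.
have LDT : L *m D^T = 0 by rewrite -LT -trmx_mul DL trmx0.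
pose X := D *m C *m P.
have XE : X = P - C *m D *m P.
  by rewrite /X -QP -!mulmxA (mulmxA C) (mulmxA D) bd_mx_cone mulmxBl -!mulmxA.
have XP : X *m P = X by rewrite /X -mulmxA PP.
have XL : X *m L = L by rewrite XE mulmxBl PL -!mulmxA PL DL mulmx0 subr0.
have LXT : L *m X^T = L by rewrite -LT -trmx_mul XL.
have LE : up_lap S = X *m ((P + L) *m X^T).
  rewrite mulmxDl mulmxDr LXT XL mulmxA XP /up_lap (face_proj_split w) mulmxDr mulmxDl addrC.
  congr (_ + _); rewrite /X !trmx_mul PT !mulmxA; congr (_ *m _ *m _).
  by rewrite -[in RHS](mulmxA _ P P) PP.
have CTP : C^T *m P = 0 by rewrite -QP mulmxA cone_tr_above mul0mx.
have DP : Q *m (D *m P) = D *m P.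
  by rewrite -[in LHS]QP !mulmxA -(mulmxA Q) bd_above -mulmxA QP.
have CCDP : C^T *m (C *m (D *m P)) = D *m P.
  by rewrite -DP !mulmxA -(mulmxA _ C) cone_tr_cone -!mulmxA.
have PC : P *m C = 0 by rewrite -PT -[C]trmxK -trmx_mul CTP trmx0.
have PX : P *m X = P by rewrite XE mulmxBr PP !mulmxA PC !mul0mx subr0.
have XTE : X^T = P - (D *m P)^T *m C^T.
  by rewrite XE linearB /= -mulmxA trmx_mul PT.
have XTX : X^T *m X = P + M.
  rewrite [in X in _ *m X]XE mulmxBr -{1}PT -trmx_mul PX PT; congr (_ + _).
  rewrite XTE mulmxBl !mulmxA PC !mul0mx add0r opprK -[in LHS]mulmxA.
  by rewrite -!mulmxA CCDP.
have LM : L *m M = 0 by rewrite /M trmx_mul PT !mulmxA LP LDT !mul0mx.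
have MP : M *m P = M by rewrite /M -!mulmxA PP.
have PM : P *m M = M by rewrite /M trmx_mul PT !mulmxA PP.
(* Exchanging the factors turns $X(P+L)X^T$ into $(P+L)X^TX=(P+L)(P+M)$, where the term $LM$
   vanishes. *)
rewrite LE (det_sub_mulmx_comm _ _ y0) -mulmxA XTX.
have -> : (P + L) *m (P + M) = P + L + M by rewrite mulmxDl !mulmxDr PP PM LP LM addr0 addrAC.
(* Since $LM=0$ and $P$ commutes with $M$, the sum $P+L+M$ splits at the cost of the factor
   $\det(y-P)$. *)
rewrite -det_sub_orthogonal ?PM ?MP //; congr (_ * _).
by rewrite det_sub_proj_mx card_face_proj.
Qed.

End SubsetMatrices.

(** * The spectrum of a shifted family *)

Section Exchange.

Variable n : nat.
Implicit Types (S : {set {set 'I_n}}) (F G : {set 'I_n}) (u v w i j : 'I_n).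

Definition degs S v : nat := #|[set F in S | v \in F]|.

Definition swap u v F : {set 'I_n} := u |: F :\ v.

Lemma swapK u v F : v \in F -> u \notin F -> swap v u (swap u v F) = F.
Proof.
move=> vF uF; rewrite /swap setU1K ?setD1K // !inE (negPf uF) andbF //.
Qed.

Lemma card_swap u v F : v \in F -> u \notin F -> #|swap u v F| = #|F|.
Proof. by move=> vF uF; rewrite cardsU1 !inE (negPf uF) andbF (cardsD1 v F) vF. Qed.

Lemma degs_split u v S :
  degs S v = (#|[set F in S | (v \in F) && (u \in F)]| +
              #|[set F in S | (v \in F) && (u \notin F)]|)%N.
Proof.
rewrite /degs -(cardsID [set F : {set 'I_n} | u \in F]); congr (_ + _)%N; apply: eq_card => F.
  by rewrite !inE andbA.
by rewrite !inE andbC -andbA.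
Qed.

Lemma card_swappable u v S :
  (#|[set F in S | [&& v \in F, u \notin F & swap u v F \in S]]| <=
   #|[set F in S | (u \in F) && (v \notin F)]|)%N.
Proof.
set X := [set F in S | _].
have Xinj : {in X &, injective (swap u v)}.
  move=> F G; rewrite !inE => /and4P[_ vF uF _] /and4P[_ vG uG _] /(congr1 (swap v u)).
  by rewrite !swapK.
rewrite -(card_in_imset Xinj); apply/subset_leq_card/subsetP => _ /imsetP[F + ->].
rewrite !inE => /and4P[_ vF uF ->]; rewrite eqxx /= eqxx /= orbF.
by apply: contraNneq uF => <-.
Qed.

(** Shiftedness through single exchanges; the threshold [m] serves an induction that strips off the
    first vertices. *)
Definition exchange_closed (m : nat) S : Prop :=
  forall F i j, F \in S -> (m <= i)%N -> (i < j)%N -> j \in F -> i \notin F -> swap i j F \in S.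

(** Faces with both vertices count for both; those with [j] only inject, by the exchange, into those
    with [i] only. *)
Lemma degs_exchange m S i j : exchange_closed m S -> (m <= i)%N -> (i < j)%N ->
  (degs S j <= degs S i)%N.
Proof.
move=> exS mi ij; rewrite (degs_split i) (degs_split j i S) leq_add //.
  by apply/subset_leq_card/subsetP => F; rewrite !inE [(j \in F) && _]andbC.
apply: leq_trans (card_swappable i j S); apply/subset_leq_card/subsetP => F.
by rewrite !inE => /and3P[FS jF iF]; rewrite FS jF iF (exS F).
Qed.

Lemma degs_cone_link w S : degs S w = #|cone_link w S|.
Proof.
have inj : {in cone_link w S &, injective (fun F => w |: F)}.
  move=> F G; rewrite !inE => /andP[wF _] /andP[wG _] /(congr1 (fun F => F :\ w)).
  by rewrite !setU1K.
rewrite -(card_in_imset inj); apply: eq_card => F; rewrite inE.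
apply/andP/imsetP => [[FS wF]|[G + ->]]; last by rewrite inE setU11 => /andP[_ ->].
by exists (F :\ w); rewrite ?inE ?eqxx setD1K.
Qed.

Lemma degs_deletion_link w v S : v != w ->
  degs S v = (degs (deletion w S) v + degs (cone_link w S) v)%N.
Proof.
move=> vw; rewrite (degs_split w) addnC; congr (_ + _)%N.
  by apply: eq_card => F; rewrite !inE -andbA [(v \in F) && _]andbC.
have inj : {in [set F in cone_link w S | v \in F] &, injective (fun F => w |: F)}.
  move=> F G; rewrite !inE -!andbA => /and3P[wF _ _] /and3P[wG _ _] /(congr1 (fun F => F :\ w)).
  by rewrite !setU1K.
rewrite /degs -(card_in_imset inj); apply: eq_card => F; rewrite inE.
apply/and3P/imsetP => [[FS vF wF]|[G + ->]].
  by exists (F :\ w); rewrite ?setD1K // !inE eqxx vw setD1K //= FS.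
by rewrite !inE eqxx => /andP[/andP[_ ->] ->]; rewrite orbT.
Qed.

Lemma drop_enum_ord m (ltmn : (m < n)%N) :
  drop m (enum 'I_n) = Ordinal ltmn :: drop m.+1 (enum 'I_n).
Proof.
rewrite (drop_nth (Ordinal ltmn)) ?size_enum_ord //; congr (_ :: _).
by apply: val_inj; rewrite /= nth_enum_ord.
Qed.

Lemma pairwise_enum_ord : pairwise (fun i j => i < j)%N (enum 'I_n).
Proof.
by rewrite -[pairwise _ _](pairwise_map val ltn) val_enum_ord -(sorted_pairwise ltn_trans) iota_ltn_sorted.
Qed.

End Exchange.

Section ShiftedSpectrum.

Variables (n : nat) (A : idomainType).
Notation N := #|{set 'I_n}|.

(** Induction on the number [m] of vertices left, the first being [w]: its deletion and link are
    exchange-closed on the later vertices and enter at [y - 1]. Excluding integer values of [y]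
    keeps the factors to be cancelled nonzero at every stage. *)
Lemma det_up_lap_exchange (m w : nat) (S : {set {set 'I_n}}) (y : A) :
    (w + m = n)%N -> {in S, forall (F : {set 'I_n}) v, v \in F -> (w <= v)%N} -> exchange_closed w S ->
    (forall i : int, y != i%:~R) ->
  \det (y%:M - up_lap A S) =
  prod_cols (fun j => y - j%:R) N (degs S) (drop w (enum 'I_n)).
Proof.
elim: m w S y => [|m IH] w S y.
  rewrite addn0 => -> supp _ _.
  (* No vertex is left, so the only possible face is the empty one, with zero boundary. *)
  have -> : up_lap A S = 0.
    rewrite /up_lap [X in X *m _](_ : _ = 0) ?mul0mx //.
    rewrite mul_fun_mx_proj; apply/matrixP => i j; rewrite !mxE; case: ifP => // jS.
    rewrite /bd big1 // => v /andP[vj _].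
    by have := supp _ jS v vj; rewrite leqNgt ltn_ord.
  rewrite subr0 det_scalar drop_oversize ?size_enum_ord // prod_cols_nil.
  by rewrite subr0.
rewrite addnS -addSn => wmn supp exS yint.
have ltwn : (w < n)%N by rewrite -wmn leq_addr.
pose v := Ordinal ltwn; rewrite (drop_enum_ord ltwn) -/v; set l := drop w.+1 _.
have y0 : y != 0 := yint 0.
have y1 : y - 1 != 0 by rewrite subr_eq0; exact: yint 1.
have y1int i : y - 1 != i%:~R.
  by rewrite subr_eq; have := yint (i + 1); rewrite intrD.
have suppD : {in deletion v S, forall (F : {set 'I_n}) u, u \in F -> (w < u)%N}.
  move=> F; rewrite inE => /andP[FS vF] u uF; have := supp F FS u uF.
  by rewrite leq_eqVlt => /orP[/eqP e|//]; move: vF; rewrite (_ : v = u) ?uF //; exact: val_inj.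
have suppL : {in cone_link v S, forall (F : {set 'I_n}) u, u \in F -> (w < u)%N}.
  move=> F; rewrite inE => /andP[vF FS] u uF; have := supp _ FS u (setU1r _ uF).
  by rewrite leq_eqVlt => /orP[/eqP e|//]; move: vF; rewrite (_ : v = u) ?uF //; exact: val_inj.
have neqv (u : 'I_n) : (w < u)%N -> v != u by move=> wu; rewrite -(inj_eq val_inj) ltn_eqF.
have exD : exchange_closed w.+1 (deletion v S).
  move=> F i j; rewrite !inE => /andP[FS vF] wi ij jF iF.
  by rewrite exS ?(ltnW wi) //= negb_or neqv //= negb_and vF orbT.
have exL : exchange_closed w.+1 (cone_link v S).
  move=> F i j; rewrite !inE => /andP[vF FS] wi ij jF iF.
  rewrite negb_or neqv //= (negPf vF) andbF /=.
  have -> : v |: swap i j F = swap i j (v |: F).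
    apply/setP => x; rewrite !inE; case: (eqVneq x v) => [->|_] //=.
    by rewrite (neqv j) ?orbT // (ltn_trans wi).
  apply: exS => //; first exact: ltnW.
    by rewrite setU1r.
  by rewrite !inE negb_or iF eq_sym neqv.
(* Replacing [u] by the smaller [v] in [F] gives a face, which is the cone over [F :\ u]. *)
have shad F u : F \in deletion v S -> u \in F -> F :\ u \in cone_link v S.
  move=> FD uF; have wu := suppD F FD u uF; move: FD; rewrite !inE => /andP[FS vF].
  by rewrite (negPf vF) andbF /=; apply: exS.
have Dab : {subset deletion v S <= above v} by move=> F FD; apply/aboveP; exact: suppD.
have Lab : {subset cone_link v S <= above v} by move=> F FD; apply/aboveP; exact: suppL.
have := det_up_lap_cone y0 Lab Dab shad.
set mL := #|cone_link v S|; set K := (N - mL)%N.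
have mLN : (mL <= N)%N := max_card _.
have lw : all (fun i : 'I_n => w < i)%N l.
  have := pairwise_enum_ord n; rewrite -(cat_take_drop w (enum 'I_n)) pairwise_cat.
  by rewrite (drop_enum_ord ltwn) /= => /and3P[_ _ /andP[]].
have pl : pairwise (fun i j : 'I_n => i < j)%N l.
  have := pairwise_enum_ord n; rewrite -(cat_take_drop w.+1 (enum 'I_n)) pairwise_cat.
  by move=> /and3P[].
have dS (i : 'I_n) : (w < i)%N -> degs S i = (degs (deletion v S) i + degs (cone_link v S) i)%N.
  by move=> wi; apply: degs_deletion_link; rewrite eq_sym neqv.
(* The first vertex has the largest degree, namely the size of its link. *)
have dSmL (i : 'I_n) : (w < i)%N -> (degs S i <= mL)%N.
  by move=> wi; rewrite /mL -degs_cone_link; exact: degs_exchange exS _ _.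
have dDmL : all (fun i => degs (deletion v S) i <= mL)%N l.
  by apply: sub_all lw => i wi; apply: leq_trans (dSmL i wi); rewrite dS // leq_addr.
have dLmL : all (fun i => degs (cone_link v S) i <= mL)%N l.
  by apply: sub_all lw => i wi; apply: leq_trans (dSmL i wi); rewrite dS // leq_addl.
(* Deletion and link have degrees sorted in the same vertex order, as [prod_cols_add] requires. *)
have sorted_degs T : exchange_closed w.+1 T -> pairwise (fun i j => degs T j <= degs T i)%N l.
  move=> exT; move: lw pl; elim: (l) => //= i l' IHl /andP[wi wl'] /andP[il' pl'].
  rewrite IHl // andbT; apply: sub_all il' => j; exact: degs_exchange exT _.
pose g1 j := y - 1 - j%:R : A.
have y1K := expf_neq0 K y1.
(* Adding the link projection moves the argument from [y - 1] to [y]; the columns beyond [mL] are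
   empty, and their factors [(y - 1) ^+ K] cancel. *)
have cancel T M : exchange_closed w.+1 T -> all (fun i => degs T i <= mL)%N l ->
    M *m face_proj A (cone_link v S) = M ->
    \det ((y - 1)%:M - M) = prod_cols g1 N (degs T) l ->
    \det (y%:M - (face_proj A (cone_link v S) + M)) = y ^+ K * prod_cols g1 mL (degs T) l.
  move=> exT dT MP detM; apply: (mulIf y1K).
  have := @det_sub_add_proj_mx _ _ (fun i => nth_set i \in cone_link v S) M y MP.
  rewrite card_face_proj -/mL -/K detM (prod_cols_widen _ mLN) // -/K => E.
  by rewrite [LHS]E /g1 subr0 [RHS]mulrC mulrA mulrAC.
rewrite (cancel (deletion v S)) //; first last.
- exact: IH wmn suppD exD y1int.
- apply: trmx_inj; rewrite trmx_mul tr_face_proj /up_lap !trmx_mul trmxK tr_face_proj.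
  by rewrite (mulmxA (bd_mx n A)) mulmxA bd_proj.
rewrite (cancel (cone_link v S)) //; first last.
(* Exchanging the factors turns the Gram matrix of the link's boundary into the link's
   up-Laplacian. *)
- rewrite det_sub_mulmx_comm // trmx_mul tr_face_proj -mulmxA (mulmxA (face_proj _ _)).
  by rewrite face_proj_sub // mulmxA; exact: IH wmn suppL exL y1int.
- by rewrite -!mulmxA face_proj_sub.
rewrite mulrACA -prod_cols_add ?sorted_degs //.
rewrite (prod_cols_widen _ (leq_addr mL mL)); last first.
  by apply: sub_all lw => i wi; rewrite -dS // dSmL.
rewrite addnK [g1 0%N]subr0 => E.
apply: (mulIf (mulf_neq0 (expf_neq0 K y0) (expf_neq0 mL y1))); rewrite {}E.
have dv : degs S v = mL by exact: degs_cone_link.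
rewrite prod_cols_cons ?dv //; last by apply: sub_all lw => i; exact: dSmL.
(* The row of [v] adds one cell to each of the first [mL] columns, and $y-(j+1)=(y-1)-j$. *)
have -> : prod_cols ((fun j => y - j%:R) \o succn) mL (degs S) l =
          prod_cols g1 mL (fun i => degs (deletion v S) i + degs (cone_link v S) i)%N l.
  apply: eq_bigr => r _ /=.
  rewrite (eq_in_count
    (a2 := fun i => r < degs (deletion v S) i + degs (cone_link v S) i)%N).
    by rewrite /g1 -natr1 opprD addrA addrAC.
  by move=> i /(allP lw) wi; rewrite dS.
by rewrite subr0 -/K mulrACA mulrC.
Qed.

End ShiftedSpectrum.

(** * Eigenvalues of real symmetric matrices *)

Section CharPoly.

Lemma char_poly_mulmxC (A : comNzRingType) (p q : nat) (U : 'M[A]_(p, q)) (V : 'M_(q, p)) :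
  char_poly (U *m V) * 'X^q = 'X^p * char_poly (V *m U).
Proof. by rewrite /char_poly /char_poly_mx !map_mxM det_sub_mulmxC. Qed.

Lemma char_poly_conj (A : fieldType) (m : nat) (V B : 'M[A]_m) : V \in unitmx ->
  char_poly (invmx V *m B *m V) = char_poly B.
Proof.
move=> Vu; apply: (mulIf (monic_neq0 (monicXn _ m))).
by rewrite -mulmxA char_poly_mulmxC mulmxK // mulrC.
Qed.

Variable R : rcfType.

(** Over the complex numbers on [R] the matrix is hermitian, hence unitarily diagonalizable with
    real eigenvalues; the polynomial and the trace are read off the diagonal form. *)
Lemma real_symmetric_spectrum (m : nat) (B : 'M[R]_m) : B^T = B ->
  exists s : seq R, char_poly B = \prod_(x <- s) ('X - x%:P) /\
                    \tr (B *m B) = \sum_(x <- s) x ^+ 2.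
Proof.
move=> symB; pose f := real_complex R; pose C := map_mx f B.
have hermC : C \is hermsymmx.
  apply/is_hermitianmxP; rewrite expr0 scale1r; apply/matrixP => i j; rewrite !mxE.
  rewrite -[in LHS]symB mxE; by apply/esym/CrealP/complex_realP; exists (B j i).
have /orthomx_spectralP := hermitian_normalmx hermC.
set V := spectralmx C; set d := spectral_diag C => Ceq.
have Vu : V \in unitmx := spectral_unit C.
have dreal i : f (complex.Re (d 0 i)) = d 0 i.
  by apply: RRe_real; have /mxOverP := hermitian_spectral_diag_real hermC; apply.
exists [seq complex.Re (d 0 i) | i <- enum 'I_m]; split.
  apply: (@map_poly_inj _ _ f); rewrite map_char_poly -/C {}Ceq.
  rewrite char_poly_conj // char_poly_trig ?diag_mx_is_trig // rmorph_prod big_map /=.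
  rewrite big_enum /=; apply: eq_bigr => i _.
  rewrite rmorphB /= map_polyX map_polyC mxE eqxx mulr1n; congr (_ - _%:P).
  exact: esym (dreal i).
apply: (@complexI R); transitivity (\tr (C *m C)).
  by rewrite -map_mxM trace_map_mx.
rewrite Ceq -!mulmxA mulKVmx // mxtrace_mulC -!mulmxA mulmxV // mulmx1.
rewrite [RHS]rmorph_sum big_map big_enum /mxtrace; apply: eq_bigr => i _.
rewrite mul_diag_mx !mxE eqxx mulr1n [RHS]rmorphXn; congr (_ ^+ 2).
by rewrite -[LHS]dreal.
Qed.

Definition nz_sorted (s : seq R) : seq R := sort >=%R [seq x <- s | x != 0].

Lemma perm_nz_sorted s s' : (forall x, x != 0 -> count_mem x s = count_mem x s') ->
  nz_sorted s = nz_sorted s'.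
Proof.
move=> ss'; apply/perm_sortP; [exact: ge_total|exact: ge_trans|exact: ge_anti|].
apply/allP => x _ /=; apply/eqP; rewrite !count_filter.
have [->|x0] := eqVneq x 0.
  by rewrite !(@eq_count _ (predI _ _) pred0) ?count_pred0 // => y /=; case: eqP.
rewrite !(@eq_count _ (predI _ _) (pred1 x)) ?ss' // => y /=;
  by case: eqP => // ->.
Qed.

Lemma count_flatten_nseq (T : eqType) (m : T -> nat) (s : seq T) x :
  count_mem x (flatten [seq nseq (m y) y | y <- s]) = (count_mem x s * m x)%N.
Proof.
elim: s => //= y s IH; rewrite count_cat IH count_nseq mulnDl /=.
by case: eqP => [->|].
Qed.

Lemma count_eigenvalues m (B : 'M[R]_m) x :
  count_mem x (eigenvalues B) = mup x (char_poly B).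
Proof.
have B0 := monic_neq0 (char_poly_monic B).
rewrite /eigenvalues count_flatten_nseq count_uniq_mem ?uniq_roots //.
have := roots_on_rootsR B0 x; rewrite in_itv /= => <-.
by case: (boolP (root _ x)) => [_|/mupNroot ->]; rewrite ?mul1n ?muln0.
Qed.

(** A power of ['X] affects only the multiplicity of the root 0, which is discarded. *)
Lemma nz_eigenvalues m (B : 'M[R]_m) a b (s : seq R) :
  char_poly B * 'X^a = 'X^b * \prod_(x <- s) ('X - x%:P) ->
  nz_sorted (eigenvalues B) = nz_sorted s.
Proof.
move=> e; apply: perm_nz_sorted => x x0; rewrite count_eigenvalues -mu_prod_XsubC.
have rX c : ~~ root ('X^c : {poly R}) x by rewrite /root hornerXn expf_neq0.
by rewrite -(mupMl _ (rX a)) e mupMr.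
Qed.

End CharPoly.

Lemma sum_enum_val_set (X : finType) (A : nmodType) (T : {set X}) (f : X -> A) :
  \sum_(i < #|T|) f (enum_val i) = \sum_(F in T) f F.
Proof. by rewrite -big_enum_val. Qed.

(** * Arbitrary orientations and relabellings *)

Section Laplacian.

Variables (n : nat) (R : rcfType).
Notation N := #|{set 'I_n}|.
Implicit Types (K S T : {set {set 'I_n}}) (p : {perm 'I_n}).

(** The determinant formula is used over the polynomial ring with [y] the indeterminate, so that its
    factors display the roots. *)
Lemma char_poly_up_lap_exchange S : exchange_closed 0 S ->
  char_poly (up_lap R S) =
  \prod_(x <- [seq (#|[set v | r < degs S v]%N|)%:R | r <- iota 0 N]) ('X - x%:P).
Proof.
move=> exS; rewrite /char_poly.
have -> : char_poly_mx (up_lap R S) = 'X%:M - up_lap {poly R} S.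
  congr (_ - _); rewrite /up_lap !map_mxM -map_trmx.
  have -> : map_mx polyC (bd_mx n R) = bd_mx n {poly R}.
    apply/matrixP => i j; rewrite !mxE rmorph_sum; apply: eq_bigr => v _.
    by rewrite rmorphXn rmorphN1.
  by congr (_ *m _ *m _); rewrite /face_proj /proj_mx map_diag_mx; congr diag_mx;
    apply/matrixP => i j; rewrite !mxE rmorph_nat.
rewrite (@det_up_lap_exchange _ _ n 0) //; last first.
  (* Integers are constant polynomials, of size at most 1, while ['X] has size 2. *)
  move=> i; apply: contra_eq_neq (size_polyX R) => ->.
  by rewrite -(rmorph_int polyC) size_polyC; case: (_ != 0).
rewrite drop0 big_map (_ : iota 0 N = index_iota 0 N); last by rewrite /index_iota subn0.
rewrite /prod_cols big_mkord; apply: eq_bigr => r _; rewrite polyC_natr; congr (_ - _%:R).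
by rewrite -size_filter cardsE cardE enumT.
Qed.

(** The signed and relabelled inclusion of the faces in [T] into the space on all subsets; its signs
    absorb the orientation. *)
Definition embed_mx (o : {set 'I_n} -> seq 'I_n) p T : 'M[R]_(N, #|T|) :=
  \matrix_(s, i) (let F : {set 'I_n} := enum_val i in
    (nth_set s == p @: F)%:R * orient_sign R o p F).

Lemma imset_perm_inj p : injective (fun F : {set 'I_n} => p @: F).
Proof. exact: imset_inj perm_inj. Qed.

Lemma sum_nth_set_pick (f : {set 'I_n} -> R) F :
  \sum_s (nth_set s == F)%:R * f (nth_set s) = f F.
Proof.
rewrite (sum_nth_set (fun G => (G == F)%:R * f G)) (bigD1 F) //= eqxx mul1r big1 ?addr0 //.
by move=> G /negPf ->; rewrite mul0r.
Qed.

Lemma embed_mx_isometry o p T : embed_mx o p T *m (embed_mx o p T)^T = face_proj R (relabel p T).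
Proof.
rewrite face_projE; apply/matrixP => i j; rewrite !mxE.
under eq_bigr => l _ do rewrite !mxE /= mulrACA orient_sign_sqr mulr1.
move: (nth_set i) (nth_set j) => G F.
transitivity (\sum_(H in T) (G == p @: H)%:R * (F == p @: H)%:R : R).
  exact: (sum_enum_val_set T (fun H : {set 'I_n} => (G == p @: H)%:R * (F == p @: H)%:R : R)).
have [/imsetP[H HT ->]|FN] := boolP (F \in relabel p T).
  rewrite andbT (bigD1 H) //= eqxx mulr1 big1 ?addr0 // => H' /andP[_ HH'].
  by rewrite (inj_eq (@imset_perm_inj p)) [H == _]eq_sym (negPf HH') mulr0.
rewrite andbF big1 // => H HT.
have /negPf -> : F != p @: H by apply: contraNneq FN => ->; rewrite imset_f.
by rewrite mulr0.
Qed.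

Lemma boundary_embed K o p k : (0 < k)%N -> orientation K o ->
  boundary_mx R o K k =
  (embed_mx o p (faces K k.-1))^T *m bd_mx n R *m embed_mx o p (faces K k).
Proof.
move=> k0 oK; apply/matrixP => i j; rewrite !mxE.
have /setIdP[GK _] := enum_valP i; have /setIdP[FK _] := enum_valP j.
rewrite (incidence_bd _ p (oK _ GK) (oK _ FK)).
set G := enum_val i; set F := enum_val j; rewrite /orient_sign -!/(orient_sign R o p _).
rewrite -(sum_nth_set_pick (fun F' => orient_sign R o p G * bd R (p @: G) F' * orient_sign R o p F)).
apply: eq_bigr => s _; rewrite !mxE.
rewrite -(sum_nth_set_pick (fun G' => orient_sign R o p G * bd R G' (nth_set s)) (p @: G)).
rewrite [RHS]mulr_suml mulr_suml mulr_sumr; apply: eq_bigr => t _; rewrite !mxE /= -/G -/F.  ring.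
Qed.

(** With $J$ the embedding of the $(k-1)$-faces and $U$ the [up_lap], the matrix is $J^TUJ$. Moving
    $J^T$ to the end gives $UJJ^T=U$, since boundaries of $k$-faces consist of $(k-1)$-faces. So
    orientation and labelling do not affect the nonzero eigenvalues. *)
Lemma char_poly_up_laplacian K o p k : (0 < k)%N -> simplicial_complex K -> orientation K o ->
  char_poly (up_laplacian R o K k) * 'X^N =
  'X^#|faces K k.-1| * char_poly (up_lap R (relabel p (faces K k))).
Proof.
move=> k0 sK oK; rewrite /up_laplacian (boundary_embed p k0 oK).
set JT := embed_mx _ _ _; set JS := embed_mx _ _ _; set D := bd_mx n R.
have -> : JT^T *m D *m JS *m (JT^T *m D *m JS)^T =
          JT^T *m (up_lap R (relabel p (faces K k)) *m JT).
  rewrite /up_lap -(embed_mx_isometry o) !trmx_mul trmxK !mulmxA; congr (_ *m _).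
rewrite char_poly_mulmxC -mulmxA embed_mx_isometry; congr (_ * char_poly _).
apply: trmx_inj; rewrite trmx_mul tr_face_proj /up_lap !trmx_mul trmxK tr_face_proj.
rewrite (mulmxA D) mulmxA bd_proj //.
move=> _ u /imsetP[F + ->] /imsetP[v vF ->]; rewrite inE => /andP[FK Fk].
rewrite -imset_setD1 imset_f // inE (sK F) ?subD1set //=.
by move: Fk; rewrite (cardsD1 v) vF add1n eqSS (prednK k0).
Qed.

End Laplacian.

(** * The trace of the squared Laplacian *)

Section SecondMoment.

Variable n : nat.
Implicit Types (S : {set {set 'I_n}}) (F G : {set 'I_n}) (u v : 'I_n).

Definition common S u v : nat := #|[set F in S | (u \in F) && (v \in F)]|.
Definition swappable S u v : nat :=
  #|[set F in S | [&& u \in F, v \notin F & swap v u F \in S]]|.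

(** Swappable faces contain [u] but not [v], and the swap injects them into the faces containing [v]
    but not [u]. *)
Lemma common_swappable_le S u v :
  (common S u v + swappable S u v <= minn (degs S u) (degs S v))%N.
Proof.
rewrite leq_min (degs_split v u S) (degs_split u v S); apply/andP; split; apply: leq_add => //.
- by apply/subset_leq_card/subsetP => F; rewrite !inE => /and4P[-> -> -> _].
- by apply/subset_leq_card/subsetP => F; rewrite !inE => /and3P[-> -> ->].
- exact: card_swappable.
Qed.

(** Equality of the sums forces equality in every termwise bound. When [v] has the smaller degree
    the minimum is that degree, so all faces containing [v] but not [u] are swappable. *)
Lemma swap_of_sum_eq S :
  (\sum_u \sum_v minn (degs S u) (degs S v) =
   \sum_u \sum_v (common S u v + swappable S u v))%N ->
  forall F u v, (degs S v <= degs S u)%N -> F \in S -> v \in F -> u \notin F -> swap u v F \in S.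
Proof.
move=> e F u v dvu FS vF uF.
have ev : (\sum_w minn (degs S v) (degs S w) = \sum_w (common S v w + swappable S v w))%N.
  have /leqif_sum : forall x, xpredT x ->
    (\sum_w (common S x w + swappable S x w) <= \sum_w minn (degs S x) (degs S w)
      ?= iff (\sum_w (common S x w + swappable S x w) == \sum_w minn (degs S x) (degs S w)))%N.
    by move=> x _; split=> //; apply: leq_sum => w _; exact: common_swappable_le.
  by case=> _; rewrite e eqxx => /esym/forallP/(_ v)/eqP.
have : (common S v u + swappable S v u = minn (degs S v) (degs S u))%N.
  have /leqif_sum : forall w, xpredT w ->
    (common S v w + swappable S v w <= minn (degs S v) (degs S w)
      ?= iff (common S v w + swappable S v w == minn (degs S v) (degs S w)))%N.
    by move=> w _; split=> //; exact: common_swappable_le.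
  by case=> _; rewrite ev eqxx => /esym/forallP/(_ u)/eqP.
rewrite (minn_idPl dvu) (degs_split u v S) => /addnI eX.
have : [set G in S | [&& v \in G, u \notin G & swap u v G \in S]] =
       [set G in S | (v \in G) && (u \notin G)].
  apply/eqP; rewrite eqEcard -/(swappable S v u) eX leqnn andbT.
  by apply/subsetP => G; rewrite !inE => /and4P[-> -> -> _].
by move/setP/(_ F); rewrite !inE FS vF uF.
Qed.

(** A squared column length counts the ordered pairs of rows reaching that column, and rows [i], [j]
    share [minn (d i) (d j)] columns. *)
Lemma sum_sqr_cols (I : finType) (d : I -> nat) (M : nat) : (forall i, d i <= M)%N ->
  (\sum_(r < M) #|[set i | r < d i]| ^ 2 = \sum_i \sum_j minn (d i) (d j))%N.
Proof.
move=> dM; transitivity (\sum_(r < M) \sum_i \sum_j (r < d i) * (r < d j))%N.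
  apply: eq_bigr => r _; rewrite -sum1dep_card big_mkcond /= -mulnn big_distrl.
  by apply: eq_bigr => i _; rewrite big_distrr; apply: eq_bigr => j _; do 2!case: ifP.
rewrite exchange_big; apply: eq_bigr => i _; rewrite exchange_big; apply: eq_bigr => j _.
have mM : (minn (d i) (d j) <= M)%N by rewrite geq_min dM.
transitivity (\sum_(r < M | r < minn (d i) (d j)) 1)%N; last first.
  by rewrite -(big_ord_widen _ (fun=> 1%N) mM) sum1_card card_ord.
rewrite [RHS]big_mkcond.
by apply: eq_bigr => r _; rewrite mulnb -leq_min; case: ifP.
Qed.

Variable R : rcfType.

Lemma sum_bd F (x : {set 'I_n} -> R) :
  \sum_G bd R G F * x G = \sum_(v in F) (-1) ^+ pos v F * x (F :\ v).
Proof.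
under eq_bigr do rewrite mulr_suml.
rewrite (exchange_big_dep (fun v => v \in F)) /=; last by move=> ? ? _ /andP[].
apply: eq_bigr => v vF; under eq_bigl do rewrite vF /=.
by rewrite big_pred1_eq.
Qed.

(** Distinct sets with a common facet differ by one exchange; the facet is then unique, and squaring
    removes its sign. On the diagonal each of the [#|F|] facets contributes 1. *)
Lemma gram_bd F G :
  (\sum_H bd R H F * bd R H G) ^+ 2 =
  ((F == G) * #|F| ^ 2 + \sum_u \sum_v [&& u \in F, v \notin F & G == swap v u F])%N%:R.
Proof.
rewrite sum_bd; have [<-|FG] := eqVneq F G.
  rewrite [X in (_ + X)%N]big1 => [|u _]; last first.
    rewrite big1 // => v _; case: and3P => // -[uF vF /eqP/setP/(_ v)].
    by rewrite !inE eqxx (negPf vF).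
  rewrite addn0 mul1n natrX; congr (_ ^+ 2).
  by rewrite (eq_bigr (fun=> 1)) ?sumr_const // => v vF; rewrite bdE // -expr2 sqrr_sign.
rewrite mul0n add0n.
have [[u v]|none] := pickP (fun p : 'I_n * 'I_n => [&& p.1 \in F, p.2 \notin F & G == swap p.2 p.1 F]).
  move=> /and3P[/= uF vF /eqP GE].
  have uv : u != v by apply: contraNneq vF => <-.
  rewrite (bigD1 u) //= [X in _ + X]big1 ?addr0; last first.
    move=> w /andP[wF wu]; rewrite /bd big1 ?mulr0 // => x /andP[_ /eqP/setP/(_ u)].
    by rewrite GE !inE eq_sym wu uF eqxx (negPf uv) /= andbF.
  have vG : v \in G by rewrite GE !inE eqxx.
  have -> : F :\ u = G :\ v by rewrite GE setU1K // !inE (negPf vF) andbF.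
  rewrite bdE // exprMn !sqrr_sign mulr1 (bigD1 u) //= (bigD1 v) //= uF vF GE eqxx.
  rewrite big1 => [|w wv]; last first.
    case: and3P => // -[_ wF /eqP/setP/(_ w)].
    by rewrite !inE eqxx (negPf wv) (negPf wF) andbF.
  rewrite big1 // => w wu; rewrite big1 // => x _; case: and3P => // -[wF xF /eqP/setP/(_ w)].
  by rewrite !inE wu wF eqxx /= orbT orbF => /esym/eqP e; move: xF; rewrite -e wF.
rewrite big1 => [|w wF]; last first.
  rewrite /bd big1 ?mulr0 // => v /andP[vG /eqP e].
  have vF : v \notin F.
    apply/negP => vF; have /setP/(_ v) := e; rewrite !inE eqxx vF andbT /= => /negbFE/eqP vw.
    by case/eqP: FG; rewrite -(setD1K vG) -e vw setD1K // -vw.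
  by have /negP[] := none (w, v); rewrite /= wF vF /swap e setD1K // eqxx.
rewrite expr0n big1 // => u _; rewrite big1 // => v _.
by have /= -> := none (u, v).
Qed.

(** By cyclicity this is the trace of $(X^TX)^2$, a sum of squared Gram entries over pairs of faces:
    the diagonal gives [common], the rest [swappable]. *)
Lemma tr_up_lap_sqr S :
  \tr (up_lap R S *m up_lap R S) = (\sum_u \sum_v (common S u v + swappable S u v))%N%:R.
Proof.
pose X := bd_mx n R *m face_proj R S.
have -> : up_lap R S = X *m X^T.
  by rewrite /X trmx_mul tr_face_proj mulmxA -[X in _ = X *m _]mulmxA face_proj_sub.
have tr_sqrC (Y Z : 'M[R]_#|{set 'I_n}|) : \tr (Y *m Z *m (Y *m Z)) = \tr (Z *m Y *m (Z *m Y)).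
  by rewrite -mulmxA mxtrace_mulC !mulmxA.
rewrite tr_sqrC.
pose g F G : R := if (F \in S) && (G \in S) then \sum_H bd R H F * bd R H G else 0.
have XX : X^T *m X = fun_mx g.
  rewrite /X mul_fun_mx_proj tr_fun_mx mul_fun_mx; apply: eq_fun_mx => F G.
  rewrite /g; case: (F \in S); case: (G \in S) => //=; rewrite big1 // => H _;
    by rewrite ?mul0r ?mulr0.
rewrite XX mul_fun_mx; transitivity (\sum_F \sum_G g F G * g G F).
  by rewrite -sum_nth_set; apply: eq_bigr => i _; rewrite mxE.
transitivity ((\sum_(F in S) \sum_(G in S)
    ((F == G) * #|F| ^ 2 + \sum_u \sum_v [&& u \in F, v \notin F & G == swap v u F]))%N%:R : R).
  rewrite natr_sum [RHS]big_mkcond; apply: eq_bigr => F _ /=.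
  case: ifP => FS; last by rewrite big1 // => G _; rewrite /g FS mul0r.
  rewrite natr_sum [RHS]big_mkcond; apply: eq_bigr => G _; rewrite /g FS andbT /=.
  case: ifP => GS; last by rewrite mul0r.
  by rewrite -gram_bd expr2; congr (_ * _); apply: eq_bigr => H _; rewrite mulrC.
congr (_%:R).
under eq_bigr do rewrite big_split /=; rewrite big_split /=.
under [RHS]eq_bigr do rewrite big_split /=; rewrite [RHS]big_split /=; congr (_ + _)%N.
  (* [#|F| ^ 2] is the number of ordered pairs of vertices of [F]. *)
  transitivity (\sum_(F in S) \sum_u \sum_v ((u \in F) && (v \in F)))%N.
    apply: eq_bigr => F FS; rewrite (bigD1 F) //= eqxx mul1n big1 ?addn0 => [|G /andP[_ /negPf]]; last first.
      by rewrite eq_sym => ->; rewrite mul0n.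
    rewrite -mulnn -sum1_card big_distrl [LHS]big_mkcond; apply: eq_bigr => u _ /=.
    case: ifP => uF; last by rewrite big1.
    by rewrite mul1n [LHS]big_mkcond; apply: eq_bigr => v _; case: ifP.
  rewrite exchange_big; apply: eq_bigr => u _; rewrite exchange_big; apply: eq_bigr => v _.
  by rewrite /common -sum1dep_card [RHS]big_mkcondr; apply: eq_bigr => F _; case: ifP.
(* For given [F], [u], [v] only [G = swap v u F] can contribute, and it does when it is a face. *)
transitivity (\sum_(F in S) \sum_u \sum_v [&& u \in F, v \notin F & swap v u F \in S])%N.
  apply: eq_bigr => F _; rewrite exchange_big; apply: eq_bigr => u _.
  rewrite exchange_big; apply: eq_bigr => v _ /=.
  case: (u \in F) => /=; last by rewrite big1.
  case: (v \in F) => /=; first by rewrite big1.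
  case: (boolP (_ \in S)) => [sS|sNS]; last first.
    by rewrite big1 // => G GS; case: eqP => // e; move: sNS; rewrite -e GS.
  by rewrite (bigD1 (swap v u F)) //= eqxx big1 ?addn0 // => G /andP[_ /negPf->].
rewrite exchange_big; apply: eq_bigr => u _; rewrite exchange_big; apply: eq_bigr => v _.
by rewrite /swappable -sum1dep_card [RHS]big_mkcondr; apply: eq_bigr => F _; case: ifP.
Qed.

End SecondMoment.

(** * Shifted complexes and exchanges *)

Section Shifted.

Variable n : nat.
Implicit Types (K S : {set {set 'I_n}}) (F G : {set 'I_n}) (u v i j : 'I_n) (p : {perm 'I_n}).

(** Threshold counts turn [le_P] into inequalities whose sides an exchange changes by at most
    one. *)
Definition below (x : nat) F : nat := #|[set u in F | (u <= x)%N]|.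

Lemma below_count x F : below x F = count (fun y => y <= x)%N [seq val u | u <- enum F].
Proof.
rewrite count_map /below cardE -size_filter; congr size.
rewrite {1}/enum_mem /enum_mem -filter_predI; apply: eq_filter => u.
by rewrite /= !inE andbC.
Qed.

Lemma le_P_below F G : le_P F G -> forall x, (below x G <= below x F)%N.
Proof.
rewrite /le_P => + x; rewrite !below_count.
elim: (enum F) (enum G) => [|a s IH] [|b t] //= /andP[ab st].
rewrite leq_add ?IH //; case: (leqP b x) => // bx.
by rewrite (leq_trans ab bx).
Qed.

(** The threshold [b], the head of [t], forces the head of [s] to be at most [b]. For the tails,
    thresholds from [b] on cost both lists one entry, and below [b] the tail of [t] is not counted
    at all. *)
Lemma all2_leq_of_count (s t : seq nat) : sorted ltn s -> sorted ltn t -> size s = size t ->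
  (forall x, count (fun y => y <= x) t <= count (fun y => y <= x) s)%N ->
  all2 leq s t.
Proof.
elim: s t => [|a s IH] [|b t] //=; rewrite !(path_sortedE ltn_trans).
move=> /andP[sa ss] /andP[tb st] [szst] ct.
have ab : (a <= b)%N.
  have := ct b; rewrite leqnn add1n; case: (leqP a b) => // ba.
  rewrite add0n (@eq_in_count _ _ pred0 s) ?count_pred0 // => y /(allP sa) /= ay.
  by rewrite leqNgt (ltn_trans ba ay).
rewrite ab IH // => x; have := ct x.
have [bx|xb] := leqP b x; first by rewrite (leq_trans ab bx) !add1n ltnS.
rewrite (@eq_in_count _ _ pred0 t) ?count_pred0 // => y /(allP tb) /= yb.
by rewrite leqNgt (ltn_trans xb yb).
Qed.

Lemma le_P_of_below F G : #|F| = #|G| -> (forall x, below x G <= below x F)%N -> le_P F G.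
Proof.
move=> FG bFG.
have so H : sorted ltn [seq val u | u <- enum H].
  rewrite sorted_map /enum_mem; apply: sorted_filter; first by move=> ? ? ?; exact: ltn_trans.
  by rewrite -enumT -(@sorted_map _ _ val ltn) val_enum_ord iota_ltn_sorted.
have : all2 leq [seq val u | u <- enum F] [seq val u | u <- enum G].
  apply: all2_leq_of_count => //; first by rewrite !size_map -!cardE.
  by move=> x; rewrite -!below_count.
rewrite /le_P; elim: (enum F) (enum G) => [|a s IH] [|b t] //= /andP[-> /=].
exact: IH.
Qed.

Lemma below_D1 x v F : v \in F -> below x F = ((v <= x) + below x (F :\ v))%N.
Proof.
move=> vF; rewrite /below (cardsD1 v) !inE vF /=; congr (_ + _)%N.
by apply: eq_card => u; rewrite !inE andbA.
Qed.

Lemma below_swap x u v F : v \in F -> u \notin F ->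
  (below x (swap u v F) + (v <= x) = below x F + (u <= x))%N.
Proof.
move=> vF uF; rewrite (below_D1 x vF) (@below_D1 x u (swap u v F)) ?setU11 //.
by rewrite /swap setU1K ?inE ?(negPf uF) ?andbF //; lia.
Qed.

Lemma shifted_exchange K : shifted K -> exchange_closed 0 K.
Proof.
move=> shK F i j FK _ ij jF iF; apply: (shK _ F) => //; first exact: card_swap.
apply: le_P_of_below => [|x]; first exact: card_swap.
have := below_swap x jF iF; have : (j <= x)%N -> (i <= x)%N by move/(leq_trans (ltnW ij)).
by case: (j <= x)%N; case: (i <= x)%N => //; lia.
Qed.

(** Induction on [#|G :\: F|]: replacing the least [j] of [G] outside [F] by the least [i] of [F]
    outside [G] keeps the threshold inequalities. *)
Lemma exchange_shifted K : exchange_closed 0 K -> shifted K.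
Proof.
move=> exK F G GK FG /le_P_below leFG.
have [m] := ubnP #|G :\: F|; elim: m G GK FG leFG => // m IH G GK FG leFG GFm.
have [GF0|[j0 jGF]] := set_0Vmem (G :\: F).
  have GsF : G \subset F by rewrite -setD_eq0 GF0.
  by have /eqP <- : G == F by rewrite eqEcard GsF FG leqnn.
have [FG0|[i0 iFG]] := set_0Vmem (F :\: G).
  have FsG : F \subset G by rewrite -setD_eq0 FG0.
  have /eqP FGe : F == G by rewrite eqEcard FsG FG leqnn.
  by move: jGF; rewrite FGe setDv inE.
case: (arg_minnP (fun u : 'I_n => val u) jGF) => j /setDP[jG jF] jmin.
case: (arg_minnP (fun u : 'I_n => val u) iFG) => i /setDP[iF iG] imin.
(* From [i] up to [j] the inequality is strict, which leaves room for the new element [i]. *)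
have below_lt x : (i <= x)%N -> (x < j)%N -> (below x G < below x F)%N.
  move=> ix xj; apply: proper_card; apply/properP; split.
    apply/subsetP => u; rewrite !inE => /andP[uG ux]; rewrite ux andbT.
    apply: contraT => uF; have /jmin /= : u \in G :\: F by rewrite inE uF.
    by rewrite leqNgt (leq_ltn_trans ux xj).
  by exists i; rewrite !inE ?iF ?(negPf iG).
have ij : (i < j)%N.
  rewrite ltn_neqAle; apply/andP; split; first by apply: contraNneq iG => /val_inj ->.
  (* If [j] came first, [G] would have more elements than [F] up to [j]. *)
  rewrite leqNgt; apply/negP => ji; have := leFG j; rewrite leqNgt => /negP; apply.
  apply: proper_card; apply/properP; split.
    apply/subsetP => u; rewrite !inE => /andP[uF uj]; rewrite uj andbT.
    apply: contraT => uG; have /imin /= : u \in F :\: G by rewrite inE uG.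
    by rewrite leqNgt (leq_ltn_trans uj ji).
  by exists j; rewrite !inE ?jG ?(negPf jF) ?leqnn.
apply: (IH (swap i j G)); first exact: exK.
- by rewrite card_swap.
- move=> x; have := below_swap x jG iG; have := leFG x.
  have [jx|xj] := leqP j x; first by rewrite (leq_trans (ltnW ij) jx); lia.
  by case: (leqP i x) => [ix|_]; [have := below_lt x ix xj|]; lia.
- rewrite -ltnS; apply: leq_trans GFm; rewrite ltnS; apply: proper_card; apply/properP; split.
    apply/subsetP => u; rewrite !inE => /andP[uF /orP[/eqP ui|/andP[_ uG]]]; last by rewrite uF.
    by move: uF; rewrite ui iF.
  by exists j; rewrite !inE ?jF ?jG // eqxx orbF /= -(inj_eq val_inj) gtn_eqF.
Qed.

(** Purity puts [F] into a [k]-face [G]; the exchanged face lies in [G] if [i] does, and otherwise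
    in the exchanged [G]. *)
Lemma pure_exchange K k : simplicial_complex K -> pure K k ->
  exchange_closed 0 (faces K k) -> exchange_closed 0 K.
Proof.
move=> sK pK exK F i j FK _ ij jF iF; have [G GK FG] := pK F FK.
have GinK : G \in K by move: GK; rewrite inE => /andP[].
have jG := subsetP FG j jF; have [iG|iG] := boolP (i \in G).
  apply: sK GinK _; apply/subsetP => u; rewrite !inE => /orP[/eqP->//|/andP[_ uF]].
  exact: (subsetP FG).
have := exK G i j GK (leq0n _) ij jG iG; rewrite inE => /andP[sGK _].
apply: sK sGK _; apply/subsetP => u; rewrite !inE => /orP[->//|/andP[-> uF]].
by rewrite (subsetP FG) ?orbT.
Qed.

Lemma exchange_faces K k : exchange_closed 0 K -> exchange_closed 0 (faces K k).
Proof.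
move=> exK F i j; rewrite !inE => /andP[FK Fk] _ ij jF iF.
by rewrite exK //= card_swap.
Qed.

Lemma mem_relabel p K F : (p @: F \in relabel p K) = (F \in K).
Proof. by rewrite mem_imset //; exact: imset_inj perm_inj. Qed.

Lemma relabelP p K G : reflect (exists2 F, F \in K & G = p @: F) (G \in relabel p K).
Proof. exact: imsetP. Qed.

Lemma relabel_faces p K k : faces (relabel p K) k = relabel p (faces K k).
Proof.
apply/setP => G; rewrite inE; apply/andP/relabelP => [[/relabelP[F FK ->]]|[F + ->]].
  by rewrite card_imset; [exists F; rewrite // inE FK|exact: perm_inj].
by rewrite inE mem_relabel card_imset; [move/andP|exact: perm_inj].
Qed.

Lemma degs_relabel p S v : degs (relabel p S) (p v) = degs S v.
Proof.
rewrite /degs -[RHS](card_imset _ (imset_inj (@perm_inj _ p))); apply: eq_card => G; rewrite inE.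
apply/andP/imsetP => [[/relabelP[F FS ->] vF]|[F + ->]].
  by exists F; rewrite // inE FS; rewrite mem_imset in vF; last exact: perm_inj.
by rewrite inE mem_relabel => /andP[-> vF]; rewrite imset_f.
Qed.

Lemma relabel_simplicial p K : simplicial_complex K -> simplicial_complex (relabel p K).
Proof.
move=> sK _ G /relabelP[F FK ->] GF.
have -> : G = p @: (p^-1%g @: G).
  by rewrite -imset_comp -[LHS]imset_id; apply: eq_imset => u /=; rewrite permKV.
rewrite mem_relabel; apply: sK FK _; apply/subsetP => _ /imsetP[u /(subsetP GF) + ->].
by case/imsetP => w wF ->; rewrite permK.
Qed.

Lemma relabel_pure p K k : pure K k -> pure (relabel p K) k.
Proof.
move=> pK _ /relabelP[F /pK[G GK FG] ->]; exists (p @: G); last exact: imsetS.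
by rewrite relabel_faces mem_relabel.
Qed.

Lemma imset_swap p u v F : p @: swap u v F = swap (p u) (p v) (p @: F).
Proof. by rewrite /swap imsetU1 imset_setD1. Qed.

Lemma sorting_perm (d : 'I_n -> nat) :
  exists p : {perm 'I_n}, forall i j, (i <= j)%N -> (d (p^-1%g j) <= d (p^-1%g i))%N.
Proof.
pose r : rel 'I_n := fun u v => (d v <= d u)%N; pose s := sort r (enum 'I_n).
have sP : perm_eq (enum 'I_n) s by rewrite perm_sym perm_sort.
have sS : sorted r s by apply: sort_sorted => u v; rewrite /r leq_total.
(* The carrying permutation sends a rank to the vertex at that place of [s]; the relabelling sends
   vertices to ranks. *)
exists (carry (enum 'I_n) s)^-1%g => i j ij; rewrite invgK.
have nthE u : carry (enum 'I_n) s u = nth u s u.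
  rewrite -[s in nth _ s](map_carry (enum_uniq _) sP) (nth_map u) ?size_enum_ord //.
  by rewrite nth_ord_enum.
rewrite !nthE (set_nth_default i j) ?size_sort ?size_enum_ord //.
move: ij; rewrite leq_eqVlt => /orP[/eqP/val_inj->//|ij].
have rT : transitive r by move=> u v w uv vw; exact: leq_trans vw uv.
by apply: (sorted_ltn_nth rT i sS); rewrite ?inE ?size_sort ?size_enum_ord.
Qed.

End Shifted.

(** * Discarding the zeroes of a list *)

Section SortedNonzero.

Variable R : rcfType.
Implicit Types s : seq R.

(** In a nonincreasing nonnegative list the zeroes stand last, where the default value 0 replaces
    them. *)
Lemma nth_nz_sorted s r : sorted >=%R s -> all (fun x => 0 <= x) s ->
  (nz_sorted s)`_r = s`_r.
Proof.
move=> ss s0; rewrite /nz_sorted sorted_sort; last exact: (sorted_filter ge_trans).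
  elim: s r ss s0 => [|x s IH] r //=; rewrite (path_sortedE ge_trans).
  move=> /andP[xs ss] /andP[x0 s0]; case: eqVneq => [e|_] /=; last by case: r => //= r; exact: IH.
  have s0' : all (pred1 0) s.
    apply/allP => y ys; rewrite /= eq_le (allP s0 y ys) andbT.
    by have := allP xs y ys; rewrite /= e.
  have /eqP -> : [seq y <- s | y != 0] == [::].
    by rewrite -size_eq0 size_filter -leqn0 leqNgt -has_count -all_predC; apply: sub_all s0' => y /= ->.
  rewrite nth_nil e -[_ :: s]/([:: 0] ++ s); case: r => //= r.
  by have [rs|rs] := ltnP r (size s); [rewrite (eqP (all_nthP 0 s0' r rs))|rewrite nth_default].
exact: ge_trans.
Qed.

Lemma sum_sqr_nz_sorted s : \sum_(x <- nz_sorted s) x ^+ 2 = \sum_(x <- s) x ^+ 2.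
Proof.
rewrite (perm_big [seq x <- s | x != 0]) /=; last by rewrite perm_sort.
rewrite big_filter [RHS](bigID (fun x => x != 0)) /= [X in _ + X]big1 ?addr0 // => x.
by rewrite negbK => /eqP->; rewrite expr0n.
Qed.

Lemma sum_nth_widen s (f : R -> R) M : f 0 = 0 -> (size s <= M)%N ->
  \sum_(x <- s) f x = \sum_(r < M) f s`_r.
Proof.
move=> f0 sM; rewrite (big_nth 0) (big_nat_widen _ _ M) // big_mkord big_mkcond /=.
by apply: eq_bigr => r _; case: ltnP => // sr; rewrite nth_default.
Qed.

End SortedNonzero.

(** * From shiftedness to the spectrum and back *)

Section Main.

Variables (R : rcfType) (n k : nat) (K : {set {set 'I_n}}) (o : {set 'I_n} -> seq 'I_n).
Hypotheses (k0 : (0 < k)%N) (sK : simplicial_complex K) (pK : pure K k) (oK : orientation K o).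
Notation N := #|{set 'I_n}|.
Notation S := (faces K k).

Lemma deg_faces (K' : {set {set 'I_n}}) v : deg K' k v = degs (faces K' k) v.
Proof. by []. Qed.

Lemma spectrum_relabel p (s : seq R) :
  char_poly (up_lap R (relabel p S)) = \prod_(x <- s) ('X - x%:P) ->
  spectrum R o K k = nz_sorted s.
Proof.
move=> cs; apply: (@nz_eigenvalues _ _ _ N #|faces K k.-1|).
by rewrite -cs; exact: char_poly_up_laplacian.
Qed.

Lemma degs_le_card (T : {set {set 'I_n}}) v : (degs T v <= N)%N.
Proof. exact: max_card. Qed.

Lemma spectrum_eq_exchange p : exchange_closed 0 (relabel p S) -> spectrum_eq_conj_deg R o K k.
Proof.
move=> exS r; rewrite (spectrum_relabel (char_poly_up_lap_exchange R exS)).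
(* Relabelling keeps column lengths, and [r' < d] is the condition [r'.+1 <= d] of [conj_deg]. *)
have cols r' : #|[set v | (r' < degs (relabel p S) v)%N]| = conj_deg K k r'.+1.
  rewrite /conj_deg -[RHS](card_imset _ (@perm_inj _ p)); apply: eq_card => v.
  rewrite -[v](permKV p) mem_imset; last exact: perm_inj.
  by rewrite !inE degs_relabel.
rewrite nth_nz_sorted; last by apply/allP => _ /mapP[r' _ ->]; rewrite ler0n.
  have [rN|Nr] := ltnP r N; first by rewrite (nth_map 0%N) ?size_iota // nth_iota // add0n cols.
  rewrite nth_default ?size_map ?size_iota // /conj_deg eq_card0 // => v.
  by rewrite !inE leqNgt ltnS (leq_trans _ Nr) // degs_le_card.
rewrite sorted_map; apply: (sub_sorted _ (iota_sorted 0 N)) => a b ab /=.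
by rewrite ler_nat; apply/subset_leq_card/subsetP => v; rewrite !inE; exact: leq_ltn_trans.
Qed.

(** Equal sequences have equal sums of squares: one is the trace of the squared Laplacian, the other
    the sum of minima of degrees, and [swap_of_sum_eq] treats this case of equality. *)
Lemma spectrum_eq_swap : spectrum_eq_conj_deg R o K k ->
  forall F u v, (degs S v <= degs S u)%N -> F \in S -> v \in F -> u \notin F -> swap u v F \in S.
Proof.
move=> specK; have [s [charS trS]] := @real_symmetric_spectrum R _ (up_lap R S) (tr_up_lap R S).
have imset1 (F : {set 'I_n}) : (1%g : {perm 'I_n}) @: F = F.
  by rewrite -[RHS]imset_id; apply: eq_imset => u; rewrite perm1.
have relabel1 : relabel 1%g S = S.
  by apply/setP => F; rewrite -[F in LHS]imset1 mem_relabel.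
have specE : spectrum R o K k = nz_sorted s by apply: (@spectrum_relabel 1%g); rewrite relabel1.
apply: swap_of_sum_eq; apply/eqP; rewrite -(eqr_nat R) -tr_up_lap_sqr trS.
rewrite -sum_sqr_nz_sorted -specE.
(* [M] bounds the length of the spectrum and all degrees, so both sums run over the same indices. *)
pose M := maxn (size (spectrum R o K k)) N.
rewrite (sum_nth_widen (M := M)) ?expr0n ?leq_maxl //.
rewrite -(@sum_sqr_cols _ _ M) => [|v]; last by rewrite (leq_trans (degs_le_card _ _)) ?leq_maxr.
rewrite natr_sum; apply/eqP; apply: eq_bigr => r _.
by rewrite natrX specK.
Qed.

(** A later vertex has no larger degree, so it may be replaced by an earlier one in any [k]-face;
    purity extends this to all faces. *)
Lemma spectrum_eq_shifted p : spectrum_eq_conj_deg R o K k ->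
  (forall i j : 'I_n, (i <= j)%N -> (deg (relabel p K) k j <= deg (relabel p K) k i)%N) ->
  shifted (relabel p K).
Proof.
move=> specK dp; apply: exchange_shifted; apply: (pure_exchange (k := k)).
- exact: relabel_simplicial.
- exact: relabel_pure.
rewrite relabel_faces => G u v /relabelP[F FS ->] _ uv.
rewrite -[u](permKV p) -[v](permKV p) !mem_imset; try exact: perm_inj.
move=> vF uF; rewrite -imset_swap mem_relabel; apply: spectrum_eq_swap => //.
have := dp u v (ltnW uv); rewrite !deg_faces relabel_faces.
by rewrite -{1}[u](permKV p) -{1}[v](permKV p) !degs_relabel.
Qed.

End Main.

Theorem theorem3p12 (R : rcfType) (n k : nat) (K : {set {set 'I_n}})
    (o : {set 'I_n} -> seq 'I_n) :
  (1 <= k)%N ->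
  simplicial_complex K -> has_dim K k -> pure K k ->
  orientation K o ->
  (spectrum_eq_conj_deg R o K k <->
     exists K' : {set {set 'I_n}},
       [/\ simplicial_complex K', shifted K' & isomorphic K K'])
  /\
  (spectrum_eq_conj_deg R o K k ->
     forall p : {perm 'I_n},
       (forall i j : 'I_n, (i <= j)%N ->
          (deg (relabel p K) k j <= deg (relabel p K) k i)%N) ->
       shifted (relabel p K)).
Proof.
move=> k0 sK _ pK oK; split; last by move=> specK p; exact: spectrum_eq_shifted specK.
split=> [specK|[K' [_ shK' [p eK']]]]; last first.
  have exS : exchange_closed 0 (relabel p (faces K k)).
    by rewrite -relabel_faces -eK'; exact/exchange_faces/shifted_exchange.
  exact: spectrum_eq_exchange exS.
(* A labelling by nonincreasing degree exists, and every such labelling is shifted. *)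
have [p pP] := sorting_perm (degs (faces K k)).
exists (relabel p K); split; [exact: relabel_simplicial| |by exists p].
apply: (spectrum_eq_shifted k0 sK pK oK specK) => u v uv.
rewrite !deg_faces relabel_faces -[u](permKV p) -[v](permKV p) !degs_relabel.
exact: pP.
Qed.
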